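(* One has the I-Wilf equivalences $54321\stackrel{I}{\sim}45312$ and $654321\stackrel{I}{\sim}456123\stackrel{I}{\sim}564312$.
   Context: Signed permutations of size $n$ are words $\pi=\pi_1\cdots\pi_n$ in which each of $1,\ldots,n$ appears exactly once up to sign; equivalently, $n\times n$ matrices with entries in $\{0,1,-1\}$ with exactly one nonzero entry in every row and column (entry $\pm1$ in position $(i,j)$ iff $\pi_i=\pm j$). $B_n$ is the set of them and $SI_n$ is the set of involutions in $B_n$ (the symmetric matrices). $\pi\in B_n$ contains $\tau\in B_k$ if there are $1\le i_1<\cdots<i_k\le n$ such that for all $a,b$, $|\pi_{i_a}|<|\pi_{i_b}|$ iff $|\tau_a|<|\tau_b|$, and $\pi_{i_a}>0$ iff $\tau_a>0$; otherwise $\pi$ avoids $\tau$. $SI_n(\tau)$ is the set of elements of $SI_n$ avoiding $\tau$. Patterns $\sigma,\tau$ are I-Wilf equivalent, $\sigma\stackrel{I}{\sim}\tau$, if $|SI_n(\sigma)|=|SI_n(\tau)|$ for all $n\ge1$. For unsigned $\sigma,\tau\in S_k$ this holds if and only if $|I_n(\sigma)|=|I_n(\tau)|$ for all $n$, where $I_n(\tau)$ is the set of involutions in the symmetric group $S_n$ avoiding $\tau$. *)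

(* Defs.v *)
From HB Require Import structures.
From mathcomp Require Import all_boot all_order all_algebra.

Set Implicit Arguments.
Unset Strict Implicit.
Unset Printing Implicit Defensive.

Import Order.TTheory GRing.Theory Num.Theory.
Local Open Scope ring_scope.

(* Signed permutations of size n, as words over the integers. *)
Record signed_perm (n : nat) := SignedPerm {
  word :> n.-tuple int;
  wordP : perm_eq [seq `|x|%N | x <- word] (iota 1 n)
}.

HB.instance Definition _ n := [isSub for @word n].
HB.instance Definition _ n := [Countable of signed_perm n by <:].

Definition sp_of_word (w : seq int)
    (wP : perm_eq [seq `|x|%N | x <- w] (iota 1 (size w))) :
    signed_perm (size w) :=
  SignedPerm (word := in_tuple w) wP.

Section FiniteSignedPerm.
Variable n : nat.

(* A letter is stored as its sign and its absolute value, which is at most n. *)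
Definition sp_code (p : signed_perm n) : {ffun 'I_n -> bool * 'I_n.+1} :=
  [ffun i => (tnth p i < 0, inord `|tnth p i|%N)].

Definition sp_decode (c : {ffun 'I_n -> bool * 'I_n.+1}) :
    option (signed_perm n) :=
  insub [tuple (-1) ^+ (c i).1 * (c i).2%:Z | i < n].

Lemma sp_letter_bounds (p : signed_perm n) i : (0 < `|tnth p i| <= n)%N.
Proof.
have: `|tnth p i|%N \in [seq `|x|%N | x <- word p] by rewrite map_f ?mem_tnth.
by rewrite (perm_mem (wordP p)) mem_iota add1n ltnS.
Qed.

Lemma sp_codeK : pcancel sp_code sp_decode.
Proof.
move=> p; rewrite /sp_decode -[RHS](valK p); congr insub.
apply: eq_from_tnth => i; rewrite tnth_mktuple ffunE /= inordK.
  by rewrite -intEsign.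
by rewrite ltnS; case/andP: (sp_letter_bounds p i).
Qed.
End FiniteSignedPerm.

HB.instance Definition _ n : isFinite (signed_perm n) :=
  PCanIsFinite (@sp_codeK n).

Definition sp_mx n (p : signed_perm n) : 'M[int]_n :=
  \matrix_(i, j) if `|tnth p i|%N == j.+1 then Num.sg (tnth p i) else 0.

(* The group law on signed permutations is the product of their matrices. *)
Definition sp_involution n (p : signed_perm n) : bool :=
  sp_mx p *m sp_mx p == 1%:M.

Definition sp_contains n k (p : signed_perm n) (t : signed_perm k) : bool :=
  [exists f : {ffun 'I_k -> 'I_n},
    [&& [forall a : 'I_k, forall b : 'I_k, (a < b)%N ==> (f a < f b)%N],
        [forall a : 'I_k, forall b : 'I_k,
          (`|tnth p (f a)| < `|tnth p (f b)|) == (`|tnth t a| < `|tnth t b|)] &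
        [forall a : 'I_k, (0 < tnth p (f a)) == (0 < tnth t a)]]].

Definition SI n : {set signed_perm n} := [set p | sp_involution p].

Definition SI_avoiding n k (t : signed_perm k) : {set signed_perm n} :=
  [set p in SI n | ~~ sp_contains p t].

Definition I_Wilf k l (s : signed_perm k) (t : signed_perm l) : Prop :=
  forall n : nat, (1 <= n)%N -> #|SI_avoiding n s| = #|SI_avoiding n t|.

Notation "s ~I t" := (I_Wilf s t) (at level 70, no associativity).

Lemma sp_mxV n (p : signed_perm n) : sp_mx p *m (sp_mx p)^T = 1%:M.
Proof.
apply/matrixP => i j; rewrite !mxE.
have /andP[p0 pn] := sp_letter_bounds p i.
have lt_pn : (`|tnth p i|.-1 < n)%N by rewrite prednK.
rewrite (bigD1 (Ordinal lt_pn)) //= big1 ?addr0 => [|k kP].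
  rewrite !mxE /= prednK // eqxx eq_sym.
  case: (eqVneq i j) => [<-|ij].
    by rewrite eqxx -expr2 sqr_sg -absz_eq0 -lt0n p0.
  case: eqP => [e|_]; last by rewrite mulr0.
  have/uniqP u : uniq [seq `|x|%N | x <- word p].
    by rewrite (perm_uniq (wordP p)) iota_uniq.
  case/eqP: ij; apply/val_inj/(u 0%N); rewrite ?inE ?size_map ?size_tuple.
  - exact: ltn_ord.
  - exact: ltn_ord.
  - by rewrite !(nth_map 0) ?size_tuple ?ltn_ord // -!tnth_nth.
rewrite !mxE; case: eqP => [e|_]; last by rewrite mul0r.
by case/eqP: kP; apply: val_inj; rewrite /= e.
Qed.

(* The involutions are the signed permutations with symmetric matrix. *)
Lemma sp_involution_sym n (p : signed_perm n) :
  sp_involution p = (sp_mx p == (sp_mx p)^T).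
Proof.
apply/eqP/eqP => [inv|sym]; last by rewrite {2}sym sp_mxV.
by rewrite -[RHS]mul1mx -inv -mulmxA sp_mxV mulmx1.
Qed.

(* Main.v *)
Require Import Defs.
From mathcomp Require Import all_boot all_order all_algebra.
From mathcomp Require Import fingroup perm zify.

Set Implicit Arguments.
Unset Strict Implicit.
Unset Printing Implicit Defensive.

(** Let f be an involution of the positions 0, ..., n-1 and D an f-stable set of
positions, those that carry a positive sign; this is what a signed involution
is. A pair i < f i inside D is an arc from i to f i. Each of the five patterns
is positive and symmetric about the diagonal, so an occurrence and its mirror
image occur together, and one of the two always has enough of its letters above
the diagonal to be read off from three points of D:
 - 654321 means three nested arcs, 456123 three mutually crossing arcs;
 - 54321 and 45312 mean two nested, respectively two crossing, arcs that both
   cover a common point of D, which may be a fixed point or the left end of an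
   arc lying below both;
 - 564312 means two crossing arcs that both cover a common arc, whereas two
   nested arcs covering a common arc are three nested arcs.
It remains to count involutions without these configurations. For that, D, the
set of left ends, the set of right ends and the values of f off the arcs are
kept fixed; what varies is the matching of left ends with right ends. Any
matching can be changed locally: at a right end t, two arcs that are open just
before t may exchange their right ends (exchangeP), so that every open arc can
be the one that closes at t, without touching what happened before t.

Nested against crossing pairs over a common point (card_nesting_crossing).
Scan the positions from left to right. The open arcs that already cover a
point are the leftmost ones, say y out of m. If the open arc with p open arcs
to its left is closed, a forbidden nested pair arises exactly when 0 < p < y,
a forbidden crossing pair exactly when p + 1 < y. In both cases one allowed
choice with p < y is left if y > 0, after which y drops by one, and every
p >= y is allowed, after which p arcs cover a point. The numbers of choices
obey the same recursion (card_no_bad_closure).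

Three nested against three crossing arcs (card_nesting_crossing3). This is the
argument of Chen, Deng, Du, Stanley and Yan. For each t, list the left ends of
the arcs straddling t by increasing right ends; crossing arcs form increasing
subsequences of this word and nested arcs decreasing ones. By the theorem of
Schensted (row_len_chain, row0_len_chain) the lengths of these are the numbers
of rows and columns of the Robinson-Schensted tableau of the word. From t to
t + 1 that tableau gains its largest entry when an arc opens, and loses a
corner by reverse insertion when an arc closes; the entry that is evicted says
which arc closes. Hence the matchings correspond to the closed walks in
the lattice of Young diagrams whose up and down steps are prescribed
(card_shapes_avoid), and transposing the diagrams interchanges rows and
columns. *)

(** * Chains and counts *)

Lemma gtn_trans : transitive gtn.
Proof. by move=> y x z /= xy yz; apply: ltn_trans xy. Qed.

Lemma subseq_consE (T : eqType) (s : seq T) a w : subseq s (a :: w) ->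
  subseq s w \/ exists2 s', s = a :: s' & subseq s' w.
Proof.
case: s => [|x s] /=; first by rewrite sub0seq; left.
by case: eqP => [->|_] sw; [right; exists s | left].
Qed.

Lemma subseq_consW (T : eqType) (s : seq T) a w : subseq s w -> subseq s (a :: w).
Proof. by move=> sw; apply: subseq_trans sw (subseq_cons _ _). Qed.

Lemma sorted_ltn_cons y s : sorted ltn (y :: s) = all (ltn y) s && sorted ltn s.
Proof. by rewrite /= path_sortedE //; exact: ltn_trans. Qed.

Lemma sorted_gtn_cons y s : sorted gtn (y :: s) = all (gtn y) s && sorted gtn s.
Proof. by rewrite /= path_sortedE //; exact: gtn_trans. Qed.

Lemma count_lt (T : eqType) (P Q : pred T) (s : seq T) x :
  subpred P Q -> x \in s -> Q x -> ~~ P x -> count P s < count Q s.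
Proof.
move=> PQ; elim: s => // y s IH; rewrite inE /=; have le_PQ := sub_count PQ s.
case: eqP => [<- _ -> /negPf-> /=|_ xs Qx nPx]; first by rewrite add0n ltnS.
by have := IH xs Qx nPx; have := PQ y; case: (P y) => [/(_ isT)->|_]; case: (Q y);
  lia.
Qed.

Lemma sub_in_count (T : eqType) (P Q : pred T) (s : seq T) :
  {in s, subpred P Q} -> count P s <= count Q s.
Proof.
move=> PQ; rewrite (@eq_in_count _ P (predI P (mem s))) => [|x xs] /=; last first.
  by rewrite xs andbT.
by apply: sub_count => x /= /andP[Px xs]; exact: PQ.
Qed.

Lemma card_by_value (T : finType) (S : {set T}) (h : T -> nat) N :
  (forall g, g \in S -> h g < N) ->
  #|S| = \sum_(c < N) #|[set g in S | h g == c]|.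
Proof.
case: N => [|N] lt_h.
  by rewrite big_ord0; apply: eq_card0 => g; apply/negP => /lt_h.
rewrite -sum1_card (partition_big (fun g => inord (h g) : 'I_N.+1) predT) //=.
apply: eq_bigr => c _; rewrite -sum1_card; apply: eq_bigl => g; rewrite inE.
case gS: (g \in S) => //=; rewrite -val_eqE /= inordK //; exact: lt_h.
Qed.

(** * Robinson-Schensted insertion *)

(** The entries of a standard tableau in decreasing order, each with the number
of its row. In this form removing the largest entry is removing the head, and
the order within rows and columns need not be stored. *)
Definition tableau := seq (nat * nat).

(** Row insertion in one pass from the smallest entry to the largest. The number
returned is the row in which the shape formed by the entries passed so far has
gained a cell; an entry that sits in this very row is pushed one row down, and
the other entries stay. This is the local rule of Fomin's growth diagrams, and
it agrees with the usual bumping procedure. *)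
Fixpoint row_insert (a : nat) (q : tableau) : nat * tableau :=
  if q is (x, r) :: q' then
    if x < a then (0, (a, 0) :: q)
    else let: (e, s) := row_insert a q' in
         if r == e then (e.+1, (x, e.+1) :: s) else (e, (x, r) :: s)
  else (0, [:: (a, 0)]).

(** Reverse insertion, from the largest entry to the smallest, starting at the
end of row c. *)
Fixpoint row_evict (c : nat) (q : tableau) : option (nat * tableau) :=
  if q is (x, r) :: q' then
    if r == c then
      if c is c'.+1 then
        if row_evict c' q' is Some (a, s) then Some (a, (x, c') :: s) else None
      else Some (x, q')
    else if row_evict c q' is Some (a, s) then Some (a, (x, r) :: s) else None
  else None.

Definition row_len (q : tableau) (r : nat) := count (fun y => y.2 == r) q.

Definition addable q r := (r == 0) || (row_len q r < row_len q r.-1).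

(** The entries up to any given value fill the diagram of a partition; this is
the condition that rows and columns increase. *)
Fixpoint is_tableau (q : tableau) :=
  if q is (_, r) :: q' then addable q' r && is_tableau q' else true.

Definition decreasing (q : tableau) := sorted gtn (unzip1 q).

Lemma decreasing_cons x r q :
  decreasing ((x, r) :: q) = all (fun y => y < x) (unzip1 q) && decreasing q.
Proof. by rewrite /decreasing /= path_sortedE //; exact: gtn_trans. Qed.

Lemma subseq_row_insert a q : subseq (unzip1 q) (unzip1 (row_insert a q).2).
Proof.
elim: q => [|[x r] q IH] //=; case: ifP => _.
  exact: (subseq_cons (unzip1 ((x, r) :: q))).
by move: IH; case: (row_insert a q) => [e s] IH; case: ifP => _ /=; rewrite eqxx.
Qed.

(** Insertion is undone without any hypothesis on q, because comparing the row of
an entry with the carry tells whether this entry is new, was pushed down or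
stayed. *)
Lemma row_evict_insert a q : row_evict (row_insert a q).1 (row_insert a q).2 =
  Some (a, q).
Proof.
elim: q => [|[x r] q IH] //=; case: ifP => // _.
case E: (row_insert a q) IH => [e s] /= IH.
by case: (eqVneq r e) => [->|re] /=; rewrite ?eqxx ?(negPf re) IH.
Qed.

Lemma row_insert_evict c q a q' : decreasing q ->
  row_evict c q = Some (a, q') -> row_insert a q' = (c, q).
Proof.
have bnd : forall q c a q', decreasing q -> row_evict c q = Some (a, q') ->
    a \in unzip1 q.
  elim=> [|[x r] {}q IH] //= c0 a0 q0; rewrite decreasing_cons => /andP[_ dq].
  case: eqP => _; last first.
    case E: (row_evict _ _) => [[b s]|] // [<- _].
    by rewrite inE (IH _ _ _ dq E) orbT.
  case: c0 => [[<- _]|c0]; first by rewrite inE eqxx.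
  case E: (row_evict _ _) => [[b s]|] // [<- _].
  by rewrite inE (IH _ _ _ dq E) orbT.
elim: q c a q' => [|[x r] q IH] c a q' //=.
rewrite decreasing_cons => /andP[/allP lt_x dq].
case: eqP => [->|rc]; last first.
  case E: (row_evict c q) => [[b s]|] // [<- <-] /=.
  rewrite ltnNge ltnW ?lt_x ?(bnd _ _ _ _ dq E) //= (IH _ _ _ dq E).
  by case: eqP.
case: c => [[<- <-]|c].
  by case: (q) lt_x => [|[y s] l] //= -> //; rewrite inE eqxx.
case E: (row_evict c q) => [[b s]|] // [<- <-] /=.
by rewrite ltnNge ltnW ?lt_x ?(bnd _ _ _ _ dq E) //= (IH _ _ _ dq E) eqxx.
Qed.

Lemma is_tableau_row_len q r : is_tableau q -> row_len q r.+1 <= row_len q r.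
Proof.
elim: q => [|[x s] q IH] //= /andP[add /IH {IH} le_q].
rewrite /row_len /=; move: le_q add; rewrite /addable /row_len.
case: s => [|s] /=; first by lia.
case: (eqVneq s.+1 r.+1) => [[->]|]; case: (eqVneq s.+1 r) => ?; lia.
Qed.

Lemma row_len_row_insert a q r :
  row_len (row_insert a q).2 r = row_len q r + (r == (row_insert a q).1).
Proof.
elim: q => [|[x s] q IH] /=; first by rewrite /row_len /= eq_sym; lia.
case: ifP => _; first by rewrite /row_len /= (eq_sym r); lia.
move: IH; rewrite /row_len; case: (row_insert a q) => [e l] /= IH.
case: (eqVneq s e) => [->|_] /=; rewrite IH; lia.
Qed.

Lemma is_tableau_row_insert a q : is_tableau q ->
  is_tableau (row_insert a q).2 && addable q (row_insert a q).1.
Proof.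
elim: q => [|[x s] q IH] //= /andP[add tq]; case: ifP => _ /=.
  by rewrite add tq.
move: (IH tq) (row_len_row_insert a q) (fun r => is_tableau_row_len r tq).
case: (row_insert a q) => [e l] /= /andP[tl adde] len_l mono.
case: (eqVneq s e) => [es|es] /=; rewrite tl ?andbT; move: add adde.
  rewrite es /addable /row_len /= -!/(row_len _ _) !len_l /= eqxx.
  by move=> _ _; have := mono e; lia.
rewrite /addable /= !len_l => adds adde.
rewrite /row_len /= -!/(row_len _ _).
by apply/andP; split; lia.
Qed.

(** Eviction from a corner never gets stuck: when it reaches an entry of row
c + 1, the entries below that value still have a corner in row c, since they
fill a diagram to which row c + 1 could be extended. *)
Lemma row_evict_corner c q : is_tableau q -> row_len q c.+1 < row_len q c ->
  exists2 aq, row_evict c q = Some aq & is_tableau aq.2 /\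
    forall r, row_len q r = row_len aq.2 r + (r == c).
Proof.
elim: q c => [|[x r] q IH] //= c /andP[add tq].
rewrite /row_len /= -!/(row_len _ _) => lt_c.
case: (eqVneq r c) lt_c => [rc|rc] lt_c; last first.
  have lt_c' : row_len q c.+1 < row_len q c by lia.
  have [[a q'] -> /= [tq' len_q]] := IH _ tq lt_c'.
  exists (a, (x, r) :: q') => //=; rewrite tq' andbT; split.
    move: add; rewrite /addable !len_q.
    case: r rc lt_c => [|s] //= rc lt_c; case: (eqVneq s c) => [E|_]; last by lia.
    by rewrite -E !len_q in lt_c *; lia.
  by move=> s; rewrite /row_len /= -!/(row_len _ _) len_q; lia.
rewrite {}rc in add lt_c *.
case: c add lt_c => [_ _|c add lt_c].
  by exists (x, q) => //=; split=> // s; rewrite addnC eq_sym.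
have lt_c' : row_len q c.+1 < row_len q c by move: add; rewrite /addable.
have [[a q'] -> /= [tq' len_q]] := IH _ tq lt_c'.
eexists; first by []; rewrite /= tq' andbT; split.
  have := fun r => is_tableau_row_len r tq.
  rewrite /addable; case: (c) len_q => [|d] //= len_q mono.
  by have := mono d; rewrite !len_q; lia.
by move=> s; rewrite /row_len /= -!/(row_len _ _) len_q; lia.
Qed.

(** The letters are inserted from the last to the first. This reverses the usual
order, so that increasing subsequences of w are measured by the rows of the
tableau and decreasing ones by its columns. *)
Fixpoint rs_tableau (w : seq nat) : tableau :=
  if w is a :: w' then (row_insert a (rs_tableau w')).2 else [::].

Lemma perm_row_insert a q : perm_eq (unzip1 (row_insert a q).2) (a :: unzip1 q).
Proof.
elim: q => [|[x r] q IH] //=; case: ifP => _ //=.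
move: IH; case: (row_insert a q) => [e s] /= IH.
rewrite perm_sym (perm_catCA [:: a] [:: x] (unzip1 q)) perm_sym /=.
by case: (eqVneq r e) => _ /=; rewrite perm_cons.
Qed.

Lemma decreasing_row_insert a q :
  decreasing q -> a \notin unzip1 q -> decreasing (row_insert a q).2.
Proof.
elim: q => [|[x r] q IH] //=; rewrite decreasing_cons inE negb_or.
move=> /andP[lt_x dq] /andP[ax aq]; case: ltnP => [xa|ax'].
  rewrite /= !decreasing_cons dq lt_x /= xa !andbT.
  by apply: sub_all lt_x => y /= /ltn_trans->.
move: (IH dq aq) (perm_row_insert a q); case: (row_insert a q) => [e s] /= ds ps.
have lt_s : all (fun y => y < x) (unzip1 s).
  by rewrite (perm_all _ ps) /= lt_x ltn_neqAle ax ax'.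
by case: ifP => _; rewrite /= decreasing_cons lt_s.
Qed.

Lemma perm_rs_tableau w : perm_eq (unzip1 (rs_tableau w)) w.
Proof.
elim: w => [|a w IH] //=.
by rewrite (perm_trans (perm_row_insert _ _)) // perm_cons.
Qed.

Lemma decreasing_rs_tableau w : uniq w -> decreasing (rs_tableau w).
Proof.
elim: w => [|a w IH] //= /andP[aw /IH dw].
by rewrite decreasing_row_insert // (perm_mem (perm_rs_tableau w)).
Qed.

Lemma is_tableau_rs_tableau w : is_tableau (rs_tableau w).
Proof. by elim: w => [|a w IH] //=; have /andP[] := is_tableau_row_insert a IH. Qed.

(** What happens to the entries below a given value does not depend on the larger
entries, so the largest letter may be deleted before or after insertion. *)
Lemma rs_tableau_max t w : uniq w -> t \in w -> all (fun x => x <= t) w ->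
  exists r, rs_tableau w = (t, r) :: rs_tableau (filter (predC1 t) w).
Proof.
elim: w => [|a w IH] //=; rewrite inE => /andP[aw uw].
case: eqVneq => [-> _|ta /= tw] /andP[a_t le_t].
  rewrite /= (@eq_in_filter _ _ predT) ?filter_predT => [|x xw /=]; last first.
    by apply: contraNneq aw => <-.
  exists 0; case E: (rs_tableau w) => [|[x r] q] //=.
  have xw : x \in w by rewrite -(perm_mem (perm_rs_tableau w)) E inE eqxx.
  case: ltnP => // ax; have := allP le_t _ xw => xa.
  by move: aw; rewrite (_ : a = x) ?xw //; lia.
have [r ->] := IH uw tw le_t.
rewrite /= ltnNge a_t /=; case: (row_insert a _) => [e s] /=.
by case: ifP => _; eexists.
Qed.

(** * The theorem of Schensted *)

(** The entry that a pushes out of the first row, which is the smallest entry of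
that row above a. *)
Fixpoint bumped_entry (a : nat) (q : tableau) : option nat :=
  if q is (x, r) :: q' then
    if x < a then None
    else if bumped_entry a q' is Some b then Some b
    else if r == 0 then Some x else None
  else None.

Fixpoint lower_rows (q : tableau) : tableau :=
  if q is (x, r) :: q' then
    if r is r'.+1 then (x, r') :: lower_rows q' else lower_rows q'
  else [::].

(** The letters that leave the first row, in the same order of time as w; their
tableau consists of the lower rows of the tableau of w (rs_tableau_bumped). This
is the word read off from Viennot's shadow lines. *)
Fixpoint bumped (w : seq nat) : seq nat :=
  if w is a :: w' then
    if bumped_entry a (rs_tableau w') is Some b then b :: bumped w' else bumped w'
  else [::].

Lemma decreasing_notin x r (q : tableau) s : decreasing ((x, r) :: q) ->
  (x, s) \notin q.
Proof.
rewrite decreasing_cons => /andP[/allP lt_x _]; apply/negP => xq.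
by have := lt_x x (map_f fst xq); rewrite ltnn.
Qed.

Variant bumped_entry_spec (a : nat) (q : tableau) : option nat -> Type :=
  | BumpedSome b of (b, 0) \in q & a < b
      & (forall y, (y, 0) \in q -> a < y -> b <= y) : bumped_entry_spec a q (Some b)
  | BumpedNone of (forall y, (y, 0) \in q -> y < a) : bumped_entry_spec a q None.

Lemma bumped_entryP a q : decreasing q -> a \notin unzip1 q ->
  bumped_entry_spec a q (bumped_entry a q).
Proof.
elim: q => [|[x r] q IH]; first by move=> _ _; constructor.
rewrite decreasing_cons inE negb_or => /andP[/allP lt_x dq] /andP[/= ax aq].
have{} lt_x y s : (y, s) \in q -> y < x by move=> yq; apply: lt_x (map_f fst yq).
rewrite [bumped_entry _ _]/=; case: ltnP => [xa|lt_ax].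
  constructor=> y; rewrite inE => /orP[/eqP[-> _] //|/lt_x yx].
  exact: ltn_trans yx xa.
case: (IH dq aq) => [b bq ab min_b|max_q].
  constructor=> // [|y]; rewrite inE ?bq ?orbT // => /orP[/eqP[-> _]|].
    by move=> _; apply/ltnW/lt_x/bq.
  exact: min_b.
case: eqVneq => [->|r0] /=; constructor; rewrite ?inE ?eqxx ?ltn_neqAle ?ax //.
  move=> y; rewrite inE => /orP[/eqP[->] //|/max_q]; lia.
by move=> y; rewrite inE => /orP[/eqP[_ E]|/max_q //]; rewrite -E in r0.
Qed.

Lemma lower_rows_le (q : tableau) x r : (x, r) \in lower_rows q -> (x, r.+1) \in q.
Proof.
elim: q => [|[y [|s]] q IH] //=; first by rewrite inE => /IH ->; rewrite orbT.
rewrite !inE; by case/orP=> [/eqP[-> ->]|/IH ->]; rewrite ?eqxx ?orbT.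
Qed.

Lemma row_len_lower_rows q r : row_len (lower_rows q) r = row_len q r.+1.
Proof. by rewrite /row_len; elim: q => [|[x [|s]] q IH] //=; rewrite IH. Qed.

Lemma row_insert_top b q : all (fun y => y < b) (unzip1 q) ->
  row_insert b q = (0, (b, 0) :: q).
Proof. by case: q => [|[x r] q] //= /andP[->]. Qed.

(** A carry that has left the first row behaves like an insertion of the bumped
entry into the remaining rows. *)
Lemma lower_rows_row_insert a q : decreasing q -> a \notin unzip1 q ->
  if bumped_entry a q is Some b then
    (row_insert a q).1 = (row_insert b (lower_rows q)).1.+1 /\
    lower_rows (row_insert a q).2 = (row_insert b (lower_rows q)).2
  else (row_insert a q).1 = 0 /\ lower_rows (row_insert a q).2 = lower_rows q.
Proof.
elim: q => [|[x r] q IH] // dq.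
have := dq; rewrite inE negb_or decreasing_cons => /andP[lt_x dq'] /andP[/= ax aq].
case: ltnP => // lt_ax; have bP := bumped_entryP dq' aq.
move: (IH dq' aq); case: bP => [b bq ab min_b|max_q]; last first.
  case: (row_insert a q) => [e s] /= [-> ls]; case: (eqVneq r 0) => [->|] /=.
    rewrite row_insert_top ?ls //; apply/allP=> y /mapP[[y' t] yq ->] /=.
    by apply: (allP lt_x); exact: (map_f fst (lower_rows_le yq)).
  by case: r {dq} => // r _; rewrite ls.
have bx : b < x by apply: (allP lt_x); exact: (map_f fst bq).
case: (row_insert a q) => [e s] /=; case E: (row_insert b _) => [e' s'] /= [-> ls].
case: r dq => [|r] dq /=; first by rewrite E ls.
rewrite eqSS ltnNge ltnW //= E; case: ifP => _ /=; by rewrite ls.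
Qed.

Lemma rs_tableau_bumped w : uniq w ->
  rs_tableau (bumped w) = lower_rows (rs_tableau w).
Proof.
elim: w => [|a w IH] //= /andP[aw uw].
have := @lower_rows_row_insert a (rs_tableau w) (decreasing_rs_tableau uw).
rewrite (perm_mem (perm_rs_tableau w)) aw => /(_ isT).
by case: (bumped_entry _ _) => [b|] /= [_ ->]; rewrite IH.
Qed.

Lemma mem_row0_insert a (q : tableau) x : decreasing q -> a \notin unzip1 q ->
  ((x, 0) \in (row_insert a q).2) = (x == a) || ((x, 0) \in q) &&
    (bumped_entry a q != Some x).
Proof.
elim: q => [|[y r] q IH] dq; first by rewrite !inE /= orbF xpair_eqE andbT.
have := dq; rewrite inE negb_or decreasing_cons => /andP[lt_y dq'] /andP[/= ay aq].
case: ltnP => // lt_ay /=; first by rewrite inE xpair_eqE andbT andbT.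
have := lower_rows_row_insert dq' aq; have := IH dq' aq.
have bP := bumped_entryP dq' aq; case: bP => [b bq ab min_b|max_q].
  case: (row_insert a q) => [e s] /= mem_s [-> _].
  have bx : b < y by apply: (allP lt_y); exact: (map_f fst bq).
  rewrite inE xpair_eqE; case: (eqVneq r _) => [->|ne] /=.
    by rewrite inE xpair_eqE andbF /= mem_s.
  rewrite inE xpair_eqE mem_s (eq_sym 0 r).
  case: (x =P y) => [->|_] //=; case: r ne {dq} => [|r] ne //=.
  by rewrite (inj_eq Some_inj) (ltn_eqF bx) orbT.
case: (row_insert a q) => [e s] /= mem_s [-> _]; rewrite inE xpair_eqE (eq_sym 0 r).
have ys t : (y, t) \in q = false by apply/negbTE/(decreasing_notin _ dq).
case: (eqVneq r 0) => [r0|r0] /=; rewrite inE xpair_eqE ?r0 /= ?mem_s ?andbF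
  ?(eq_sym 0) ?(negPf r0) ?andbF //=.
  rewrite (inj_eq Some_inj) (eq_sym y).
  by case: (x =P y) => [->|_] /=; rewrite ?ys ?andbF ?andbT.
Qed.

Definition chain (r : rel nat) k (w : seq nat) :=
  exists s, [/\ subseq s w, sorted r s & size s = k].

(** When a letter x is inserted while a larger first-row entry y is present, it
pushes out an entry b with x < b <= y, and if y is gone, then y itself has been
pushed out. So each further letter of a chain yields a further bumped letter.
The two alternatives say whether y still sits in the first row. *)
Lemma chain_to_bumped w y s : uniq w -> sorted ltn (y :: s) -> subseq (y :: s) w ->
  exists u, [/\ subseq u (bumped w), sorted ltn u &
    ((y, 0) \in rs_tableau w /\ size u = size s /\ all (ltn y) u) \/
    (size u = (size s).+1 /\ all (leq y) u)].
Proof.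
elim: w y s => [|a w IH] // y s /= /andP[aw uw] ys.
have dw := decreasing_rs_tableau uw; have aq : a \notin unzip1 (rs_tableau w).
  by rewrite (perm_mem (perm_rs_tableau w)).
have bP := bumped_entryP dw aq; have r0 := fun x => mem_row0_insert x dw aq.
move: ys; move/[swap]; case/(@subseq_consE _ (y :: s)) =>
  [ysw ys|[s' [-> ->] sw] ys].
  have [u [uw' su [[yw [sz gt_u]]|ge_u]]] := IH y s uw ys ysw; last first.
    by exists u; split=> //; [case: bP => // b _ _ _; exact: subseq_consW | right].
  case: bP r0 => [b bq ab min_b|_] r0; last first.
    by exists u; split=> //; left; rewrite r0 yw orbT.
  case: (eqVneq b y) => [->|by_].
    exists (y :: u); rewrite /= eqxx; split=> //.
      by rewrite path_sortedE ?gt_u //; exact: ltn_trans.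
    right; rewrite sz leqnn; split=> //.
    by apply: sub_all gt_u => x /ltnW.
  exists u; split=> //; first exact: subseq_consW.
  by left; rewrite r0 yw (inj_eq Some_inj) by_ orbT.
case: s' sw ys => [_ _|y' s' sw]; first by exists [::]; split; rewrite ?sub0seq //;
  left; rewrite r0 eqxx.
move=> /= /andP[ay' ys].
have [u [uw' su [[yw [sz gt_u]]|[sz ge_u]]]] := IH y' s' uw ys sw; last first.
  exists u; split=> //; first by case: bP => // b _ _ _; exact: subseq_consW.
  by left; rewrite r0 eqxx sz; split=> //; split=> //; apply: sub_all ge_u => x;
    apply: leq_trans.
case: bP r0 => [b bq ab min_b|max_q] r0; last first.
  by have := ltn_trans ay' (max_q _ yw); rewrite ltnn.
have by' := min_b _ yw ay'.
have bu : all (ltn b) u by apply: sub_all gt_u => x /=; exact: leq_ltn_trans.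
exists (b :: u); rewrite sorted_ltn_cons bu su /= eqxx; split=> //.
left; rewrite r0 eqxx ab sz; split=> //; split=> //.
by apply: sub_all bu => x /=; exact: ltn_trans.
Qed.

(** Consider two successive bumped letters c > b of a chain u, the letter c being
pushed out by a. Either b was in the first row at that moment, and then
b < a < c and a continues the chain of letters of w built so far, or b was
inserted later and continues it itself. The first conjunct anticipates this
choice for a first-row entry b that may be bumped later. *)
Lemma chain_from_bumped w u : uniq w -> subseq u (bumped w) -> sorted ltn u ->
  (forall b, (b, 0) \in rs_tableau w -> all (ltn b) u ->
   exists s, [/\ subseq s w, sorted ltn s, size s = (size u).+1 & all (leq b) s]) /\
  exists s, [/\ subseq s w, sorted ltn s, size s = size u & all (leq (head 0 u)) s].
Proof.
elim: w u => [|a w IH] u.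
  by rewrite subseq0 => _ /eqP -> _; split=> //; exists [::].
move=> /= /andP[aw uw] uw' su.
have dw := decreasing_rs_tableau uw; have aq : a \notin unzip1 (rs_tableau w).
  by rewrite (perm_mem (perm_rs_tableau w)).
have bP := bumped_entryP dw aq; have r0 := fun x => mem_row0_insert x dw aq.
have weaken k b (t : seq nat) :
    (exists s, [/\ subseq s w, sorted ltn s, size s = k & all (leq b) s]) ->
    exists s, [/\ subseq s (a :: w), sorted ltn s, size s = k & all (leq b) s].
  by case=> s [sw ss sz ge_s]; exists s; split=> //; exact: subseq_consW.
have extend k b c : a < c -> b <= a ->
    (exists s, [/\ subseq s w, sorted ltn s, size s = k & all (leq c) s]) ->
    exists s, [/\ subseq s (a :: w), sorted ltn s, size s = k.+1 & all (leq b) s].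
  move=> ac ba [s [sw ss sz ge_s]]; exists (a :: s);
    rewrite sorted_ltn_cons ss andbT.
  rewrite /= eqxx sz ba; split=> //; apply: sub_all ge_s => x /=; lia.
have inner : subseq u (bumped w) ->
  (forall b, (b, 0) \in (row_insert a (rs_tableau w)).2 -> all (ltn b) u ->
   exists s, [/\ subseq s (a :: w), sorted ltn s, size s = (size u).+1 & all
     (leq b) s]) /\
  exists s, [/\ subseq s (a :: w), sorted ltn s, size s =
    size u & all (leq (head 0 u)) s].
  move=> {}uw'; have [IHb IHc] := IH u uw uw' su; split; last exact: weaken.
  move=> b; rewrite r0 => /orP[/eqP->|/andP[bw _] /(IHb b bw)]; last exact: weaken.
  case: u uw' su IHc {IHb} => [|c u] uw' su IHc.
    by move=> _; exists [:: a]; rewrite /= eqxx sub0seq leqnn.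
  by move=> /= /andP[ac _]; apply: extend ac _ IHc.
case: bP r0 uw' => [b0 bq ab min_b|_] r0; last exact: inner.
case/subseq_consE => [|[u' eu uw']]; first exact: inner.
move: su; rewrite {}eu {inner} sorted_ltn_cons => /andP[bu su'].
have [IHb _] := IH u' uw uw' su'; have {}IHb := IHb _ bq bu.
split=> /=; last exact: weaken.
move=> b; rewrite r0 => b_row /andP[bb0 _]; apply: extend ab _ IHb.
case/orP: b_row => [/eqP-> //|/andP[bw _]].
by rewrite leqNgt; apply/negP => /(min_b _ bw); rewrite leqNgt bb0.
Qed.

(** Passing to the bumped word shortens the longest increasing chain by one
(Viennot). *)
Lemma chain_bumped k w : uniq w -> chain ltn k.+2 w <-> chain ltn k.+1 (bumped w).
Proof.
move=> uw; split=> [[[|y s] [sw ss //= [sz]]]|[u [uw' su]]].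
  have [u [uw' su sz']] := chain_to_bumped uw ss sw.
  have ge_k : k.+1 <= size u by case: sz' => [[_ []]|[]]; lia.
  exists (take k.+1 u); split; last by rewrite size_takel.
    exact: subseq_trans (take_subseq _ _) uw'.
  exact: take_sorted.
case: u uw' su => [|b u] // uw' su [sz].
elim: w uw uw' => [|a w IH] //= /andP[aw uw].
have dw := decreasing_rs_tableau uw; have aq : a \notin unzip1 (rs_tableau w).
  by rewrite (perm_mem (perm_rs_tableau w)).
have weaken : chain ltn k.+2 w -> chain ltn k.+2 (a :: w).
  by case=> s [sw ss sz']; exists s; split=> //; exact: subseq_consW.
case: bumped_entryP => // [b0 bq ab min_b|_]; last by move/(IH uw).
case/(@subseq_consE _ (b :: u)) => [/(IH uw) //|[u' [eb eu] uw']].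
move: su; rewrite eb sorted_ltn_cons => /andP[bu su'].
rewrite -eu in uw'.
have [/(_ _ bq bu) [s [sw ss sz' ge_s]] _] := chain_from_bumped uw uw' su'.
exists (a :: s); rewrite sorted_ltn_cons ss /= eqxx sz' sz; split=> //.
by rewrite andbT; apply: sub_all ge_s => x /=; exact: leq_trans.
Qed.

Lemma uniq_bumped w : uniq w -> uniq (bumped w).
Proof.
move=> uw; rewrite -(perm_uniq (perm_rs_tableau _)) rs_tableau_bumped //.
have: uniq (unzip1 (rs_tableau w)) by rewrite (perm_uniq (perm_rs_tableau w)).
apply: subseq_uniq; elim: (rs_tableau w) => [|[x [|r]] q IH] //=;
  last by rewrite eqxx.
exact: subseq_consW.
Qed.

(** Row k is the first row of the k-th iterated bumped word, so it is nonempty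
exactly when increasing chains can be shortened k times. *)
Lemma row_len_chain k w : uniq w -> (0 < row_len (rs_tableau w) k) <->
  chain ltn k.+1 w.
Proof.
elim: k w => [|k IH] w uw; last first.
  rewrite chain_bumped // -IH ?uniq_bumped // rs_tableau_bumped //.
  by rewrite row_len_lower_rows.
split.
  case: w uw => [|a w] // _ _; exists [:: a]; split=> //=.
  by rewrite eqxx sub0seq.
case=> s [sw _ sz]; case: w uw sw => [_|a w /andP[aw uw] _].
  by rewrite subseq0 => /eqP es; rewrite es in sz.
rewrite [rs_tableau _]/=.
have aq : a \notin unzip1 (rs_tableau w) by rewrite (perm_mem (perm_rs_tableau w)).
have := mem_row0_insert a (decreasing_rs_tableau uw) aq.
by rewrite eqxx /= /row_len -has_count => aw0; apply/hasP; exists (a, 0).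
Qed.

Definition row0_lt (q : tableau) x := count (fun y => (y.2 == 0) && (y.1 < x)) q.

Lemma row0_lt_insert a (q : tableau) x : decreasing q -> a \notin unzip1 q ->
  row0_lt (row_insert a q).2 x + (if bumped_entry a q is Some b then b < x else
    false) =
  row0_lt q x + (a < x).
Proof.
elim: q => [|[y r] q IH] dq; first by rewrite /row0_lt /=; lia.
have := dq; rewrite inE negb_or decreasing_cons => /andP[lt_y dq'] /andP[/= ay aq].
case: ltnP => // lt_ay /=; first by rewrite /row0_lt /=; lia.
have := lower_rows_row_insert dq' aq; have := IH dq' aq; rewrite /row0_lt.
case: (bumped_entry a q) => [b|]; case: (row_insert a q) => [e s] /= cnt [-> _].
  by case: (eqVneq r _) => [->|ne] /=; lia.
by case: (eqVneq r 0) => [r0|/negPf ne] /=; rewrite ?r0 ?ne /=; lia.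
Qed.

(** Along a decreasing subsequence, read in the order of insertion, the number of
first-row entries up to the current letter grows: the letter is added and the
entry it displaces is larger. *)
Lemma row0_lt_chain w y s : uniq w -> sorted gtn (y :: s) -> subseq (y :: s) w ->
  size s < row0_lt (rs_tableau w) y.+1.
Proof.
elim: w y s => [|a w IH] // y s /andP[aw uw] ys.
have dw := decreasing_rs_tableau uw; have aq : a \notin unzip1 (rs_tableau w).
  by rewrite (perm_mem (perm_rs_tableau w)).
have bP := bumped_entryP dw aq; have cnt := fun x => row0_lt_insert x dw aq.
rewrite [rs_tableau _]/=; move: ys; move/[swap].
case/(@subseq_consE _ (y :: s)) => [ysw ys|[s' [-> ->] sw] ys].
  by have := cnt y.+1; have := IH y s uw ys ysw; case: bP => [b _ ab _|_]; lia.
have := cnt a.+1; rewrite leqnn.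
case: s' sw ys => [_ _|y' s' sw]; first by case: bP => [b _ ab _|_] /=; lia.
move=> /= /andP[ay' ys]; have := IH y' s' uw ys sw.
suff: row0_lt (rs_tableau w) y'.+1 <= row0_lt (rs_tableau w) a.+1 by case:
  bP => [b _ ab _|_] /=; lia.
by apply: sub_count => z /=; lia.
Qed.

(** The first-row entries below x need not form a subsequence of w, but there is
one of the same length: when a enters below x without displacing an entry
below x, all other first-row entries below x lie below a, and a extends the
sequence found for the bound a. *)
Lemma chain_row0_lt w x : uniq w -> exists s,
  [/\ subseq s w, sorted gtn s, size s = row0_lt (rs_tableau w) x & all
    (fun y => y < x) s].
Proof.
elim: w x => [|a w IH] x; first by exists [::].
move=> /andP[aw uw].
have dw := decreasing_rs_tableau uw; have aq : a \notin unzip1 (rs_tableau w).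
  by rewrite (perm_mem (perm_rs_tableau w)).
have bP := bumped_entryP dw aq; have cnt := fun x => row0_lt_insert x dw aq.
rewrite [rs_tableau _]/=.
have weaken : row0_lt (row_insert a (rs_tableau w)).2 x = row0_lt (rs_tableau w)
  x -> exists s,
  [/\ subseq s (a :: w), sorted gtn s, size s =
    row0_lt (row_insert a (rs_tableau w)).2 x
    & all (fun y => y < x) s].
  move=> ->; have [s [sw ss sz lt_s]] := IH x uw; exists s; split=> //.
  exact: subseq_consW.
case: (leqP x a) => [xa|ax].
  by apply: weaken; have := cnt x; case: bP => [b _ ab _|_]; lia.
case: (bumped_entry _ _) / bP weaken cnt => [b bq ab min_b|max_q] weaken cnt.
  case: (ltnP b x) => bx; first by apply: weaken; have := cnt x; lia.
  have E : row0_lt (rs_tableau w) x = row0_lt (rs_tableau w) a.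
    apply: eq_in_count => -[y r] /=; case: eqP => [->|] //= yq.
    have ya : y != a by apply: contraNneq aq => <-; exact: (map_f fst yq).
    by have := min_b y yq; lia.
  have [s [sw ss sz lt_s]] := IH a uw; exists (a :: s).
  rewrite sorted_gtn_cons ss andbT /= eqxx; split=> //; first by rewrite sz -E;
    have := cnt x; lia.
  by rewrite ax; apply: sub_all lt_s => y; lia.
have E : row0_lt (rs_tableau w) x = row0_lt (rs_tableau w) a.
  apply: eq_in_count => -[y r] /=; case: eqP => [->|] //= yq.
  by have := max_q y yq; lia.
have [s [sw ss sz lt_s]] := IH a uw; exists (a :: s).
rewrite sorted_gtn_cons ss andbT /= eqxx; split=> //; first by rewrite sz -E;
  have := cnt x; lia.
by rewrite ax; apply: sub_all lt_s => y; lia.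
Qed.

Lemma row0_len_chain k w : uniq w -> k <= row_len (rs_tableau w) 0 <->
  chain gtn k w.
Proof.
move=> uw; split=> [le_k|[[|y s] [sw ss <-]] //]; last first.
  apply: leq_trans (row0_lt_chain uw ss sw) _.
  by apply: sub_count => z /= /andP[].
have [x lt_x] : exists x, all (fun y => y.1 < x) (rs_tableau w).
  exists (\max_(y <- rs_tableau w) y.1).+1; apply/allP => y yw.
  by rewrite ltnS; exact: leq_bigmax_seq.
have [s [sw ss sz _]] := chain_row0_lt x uw.
have {}sz : size s = row_len (rs_tableau w) 0.
  rewrite sz; apply: eq_in_count => y /(allP lt_x) ->; exact: andbT.
exists (take k s); split; last by rewrite size_takel ?sz.
  exact: subseq_trans (take_subseq _ _) sw.
exact: take_sorted.
Qed.

(** * Walks among Young diagrams *)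

(** The role of a position: left end of an arc, right end of an arc, fixed point
with positive sign, or none of these. *)
Inductive step := Up | Down | Dot | Idle.

(** Diagrams as sets of cells (row, column), for which transposition is immediate. *)
Definition cells := nat -> nat -> bool.

Definition outer_corner (Y : cells) r c :=
  [&& ~~ Y r c, (r == 0) || Y r.-1 c & (c == 0) || Y r c.-1].
Definition inner_corner (Y : cells) r c := [&& Y r c, ~~ Y r.+1 c & ~~ Y r c.+1].
Definition add_cell (Y : cells) r c : cells :=
  fun i j => Y i j || ((i == r) && (j == c)).
Definition del_cell (Y : cells) r c : cells :=
  fun i j => Y i j && ~~ ((i == r) && (j == c)).

(** Walks in the lattice of Young diagrams with prescribed up and down steps. A
diagram without the cell (k, 0) has at most k rows, one without (0, k) at most
k columns. The bound N makes the sums finite. *)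
Fixpoint shape_walks r0 c0 N (st : seq step) (Y : cells) : nat :=
  if Y r0 c0 then 0 else
  match st with
  | [::] => 1
  | Up :: st' => \sum_(r < N) \sum_(c < N)
      if outer_corner Y r c then shape_walks r0 c0 N st' (add_cell Y r c) else 0
  | Down :: st' => \sum_(r < N) \sum_(c < N)
      if inner_corner Y r c then shape_walks r0 c0 N st' (del_cell Y r c) else 0
  | _ :: st' => shape_walks r0 c0 N st' Y
  end.

Lemma eq_shape_walks r0 c0 N st (Y Y' : cells) :
  Y =2 Y' -> shape_walks r0 c0 N st Y = shape_walks r0 c0 N st Y'.
Proof.
elim: st Y Y' => [|s st IH] Y Y' eqY /=; rewrite eqY //.
case: ifP => // _; case: s; try exact: IH; apply: eq_bigr => r _;
  apply: eq_bigr => c _; rewrite /outer_corner /inner_corner !eqY;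
    case: ifP => // _;
  by apply: IH => i j; rewrite /add_cell /del_cell eqY.
Qed.

Lemma shape_walks_transpose r0 c0 N st (Y : cells) :
  shape_walks r0 c0 N st Y = shape_walks c0 r0 N st (fun i j => Y j i).
Proof.
elim: st Y => [|s st IH] Y //=; case: ifP => // _.
case: s; try exact: IH; rewrite exchange_big /=; apply: eq_bigr => r _;
  apply: eq_bigr => c _; rewrite /outer_corner /inner_corner.
  rewrite (andbC (_ || _)); case: ifP => // _; rewrite IH.
  by apply: eq_shape_walks => i j; rewrite /add_cell andbC.
rewrite (andbC (~~ _)); case: ifP => // _; rewrite IH.
by apply: eq_shape_walks => i j; rewrite /del_cell (andbC (i == _)).
Qed.

Definition diagram (q : tableau) : cells := fun r c => c < row_len q r.

Lemma diagram_add q x r : add_cell (diagram q) r (row_len q r) =2 diagram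
  ((x, r) :: q).
Proof.
move=> i j; rewrite /add_cell /diagram /row_len /= -!/(row_len _ _) (eq_sym i).
by case: eqP => [->|_] /=; lia.
Qed.

Lemma diagram_del q q' c : (forall r, row_len q r = row_len q' r + (r == c)) ->
  del_cell (diagram q) c (row_len q c).-1 =2 diagram q'.
Proof.
move=> len_q i j; rewrite /del_cell /diagram.
by case: eqP => [->|ne] /=; rewrite !len_q ?eqxx; [|move/eqP/negPf: ne => ->]; lia.
Qed.

Lemma sum_pred1 N (F : nat -> nat) b k : k < N ->
  \sum_(c < N) (if b && (c == k :> nat) then F c else 0) = if b then F k else 0.
Proof.
move=> kN; rewrite (bigD1 (Ordinal kN)) //= eqxx andbT big1 ?addn0 // => c ne_c.
by rewrite -[c == k :> nat]/(c == Ordinal kN) (negPf ne_c) andbF.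
Qed.

Lemma sum_outer q r N (F : nat -> nat) : row_len q r < N ->
  \sum_(c < N) (if outer_corner (diagram q) r c then F c else 0) =
  if addable q r then F (row_len q r) else 0.
Proof.
move=> lt_N; rewrite -(sum_pred1 F _ lt_N); apply: eq_bigr => c _.
congr (if _ then _ else _); rewrite /outer_corner /diagram /addable.
by case: r {lt_N} => [|r] /=; case: eqVneq; lia.
Qed.

Lemma sum_inner q r N (F : nat -> nat) : row_len q r <= N ->
  \sum_(c < N) (if inner_corner (diagram q) r c then F c else 0) =
  if row_len q r.+1 < row_len q r then F (row_len q r).-1 else 0.
Proof.
move=> le_N; case: ltnP => [lt_r|ge_r].
  have lt_N : (row_len q r).-1 < N by lia.
  have /= <- := sum_pred1 F true lt_N; apply: eq_bigr => c _.
  by congr (if _ then _ else _); rewrite /inner_corner /diagram; lia.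
by rewrite big1 // => c _; rewrite /inner_corner /diagram; case: ifP => //; lia.
Qed.

Lemma tableau_row_lt q r : is_tableau q -> 0 < row_len q r -> r < size q.
Proof.
elim: q r => [|[x s] q IH] r //= /andP[add tq]; rewrite /row_len /= -/(row_len q r).
case: (eqVneq s r) => [<- _|_ /(IH _ tq)]; last by rewrite ltnS => /ltnW.
move: add; rewrite /addable; case: s => //= s lt_s.
by rewrite ltnS; apply: IH => //; lia.
Qed.

(** * Involutions and their arcs *)

Section Involutions.
Variables (n : nat) (D : {set 'I_n}).
Implicit Types (f g : {ffun 'I_n -> 'I_n}) (i j a b c : 'I_n) (t : nat).

Definition stable_inv f :=
  [forall i, f (f i) == i] && [forall i, (f i \in D) == (i \in D)].

(** What is kept fixed while the matching of left ends with right ends varies. *)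
Definition background f i : bool + 'I_n :=
  if (i \in D) && (f i != i) then inl (i < f i) else inr (f i).

Definition step_of f i :=
  match background f i with
  | inl true => Up | inl false => Down
  | inr _ => if i \in D then Dot else Idle
  end.
Definition steps f := [seq step_of f i | i <- enum 'I_n].

(** These classes shrink from the whole background class of f at t = 0 to f alone
at t = n, and counting proceeds by induction from the small ones to the large. *)
Definition agree t f := [set g | stable_inv g & [forall i,
  (background g i == background f i) && ((f i < i) && (i < t) ==> (g i == f i))]].

(** Arcs are represented by their left ends. *)
Definition open_arcs t f := [seq i <- enum 'I_n | [&& i \in D, i < t & t <= f i]].

Lemma stable_invK f : stable_inv f -> forall i, f (f i) = i.
Proof. by case/andP=> /forallP fK _ i; apply/eqP. Qed.

Lemma stable_invD f : stable_inv f -> forall i, (f i \in D) = (i \in D).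
Proof. by case/andP=> _ /forallP fD i; apply/eqP. Qed.

Lemma agreeP t f g : reflect [/\ stable_inv g, background g =1 background f &
   forall i, f i < i -> i < t -> g i = f i] (g \in agree t f).
Proof.
rewrite inE; apply: (iffP andP) => [[-> /forallP gf]|[-> gf_key gf]]; split=> //.
- by move=> i; have /andP[/eqP] := gf i.
- by move=> i lt_i it; have /andP[_] := gf i; rewrite lt_i it => /eqP.
- by apply/forallP=> i; rewrite gf_key eqxx; apply/implyP=> /andP[lt_i it];
  rewrite gf.
Qed.

Lemma background_lt f g i : background g i = background f i ->
  ((g i < i) = (f i < i)) * ((i < g i) = (i < f i)).
Proof.
rewrite /background; case: (i \in D) => /= [|[->] //].
case: (eqVneq (g i) i) => [->|gi]; case: (eqVneq (f i) i) => [-> //|fi] //=;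
  last first.
  by case=> lt_i; split=> //; rewrite !ltn_neqAle gi fi /= leqNgt lt_i -leqNgt.
Qed.

Lemma background_fix f g i : background g i = background f i ->
  ~~ ((i \in D) && (f i != i)) -> g i = f i.
Proof.
rewrite /background; case: (i \in D) => /= [|[->] //]; rewrite negbK => E /eqP fi.
by move: E; rewrite fi eqxx /=; case: eqP => [->|].
Qed.

Lemma agree_refl t f : stable_inv f -> f \in agree t f.
Proof. by move=> fP; apply/agreeP. Qed.

Lemma agree_sym t f g : stable_inv f -> g \in agree t f -> f \in agree t g.
Proof.
move=> fP /agreeP[gP gf_key gf]; apply/agreeP; split=> // i.
by rewrite (background_lt (gf_key i)) => lt_i it; rewrite gf.
Qed.

Lemma agree_below t f g i : stable_inv f -> g \in agree t f ->
  i < t -> f i < t -> g i = f i.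
Proof.
move=> fP /agreeP[gP gf_key gf] it fit.
case: (ltngtP (f i) i) => [lt_i|gt_i|/val_inj eq_i]; first exact: gf.
  by rewrite -{1}(stable_invK fP i) -gf ?(stable_invK gP) ?(stable_invK fP).
by apply: background_fix; rewrite ?eq_i ?eqxx ?andbF.
Qed.

Lemma open_arcs_agree t f g : stable_inv f -> g \in agree t f ->
  open_arcs t g = open_arcs t f.
Proof.
move=> fP gf; have gP : stable_inv g by case/agreeP: gf.
apply: eq_filter => i; case: (i \in D) => //=; case it: (i < t) => //=.
rewrite (leqNgt t (g i)) (leqNgt t (f i)); congr negb.
apply/idP/idP => lt_t.
  by rewrite (agree_below gP (agree_sym fP gf)).
by rewrite (agree_below fP gf).
Qed.

Lemma agree_step (t : 'I_n) f f' g : f' \in agree t f -> f' t < t ->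
  (g \in agree t.+1 f') = (g \in agree t f) && (g t == f' t).
Proof.
case/agreeP=> [f'P key' f'f] lt_t.
apply/agreeP/andP => [[gP gkey gf']|[/agreeP[gP gkey gf] /eqP gt]].
  split; last by apply/eqP/gf'.
  apply/agreeP; split=> // [i|i lt_i it]; first by rewrite gkey key'.
  by rewrite -f'f // gf' ?(background_lt (key' i)) // ltnW.
split=> // [i|i]; first by rewrite gkey key'.
rewrite (background_lt (key' i)) => lt_i;
  rewrite ltnS leq_eqVlt => /orP[/eqP/val_inj->//|it].
by rewrite gf ?f'f.
Qed.

Lemma agree_stay (t : 'I_n) f : ~~ ((t \in D) && (f t < t)) ->
  agree t.+1 f = agree t f.
Proof.
move=> not_down; apply/setP=> g.
apply/agreeP/agreeP => -[gP gkey gf]; split=> // i lt_i.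
  by move=> it; rewrite gf // ltnW.
rewrite ltnS leq_eqVlt => /orP[/eqP/val_inj it|]; last exact: gf.
rewrite it in lt_i *; apply: background_fix => //.
by apply: contra not_down => /andP[->].
Qed.

Lemma agree_all f : stable_inv f -> agree n f = [set f].
Proof.
move=> fP; apply/setP=> g; rewrite [RHS]inE; apply/idP/eqP => [gf|->].
  by apply/ffunP=> i; rewrite (agree_below fP gf).
exact: agree_refl.
Qed.

Lemma mem_open_arcs t f a : (a \in open_arcs t f) = [&& a \in D, a < t & t <= f a].
Proof. by rewrite mem_filter mem_enum andbT. Qed.

(** Conjugation by the transposition of two left ends, that of a and that of the
arc closing at t, exchanges the right ends of these two arcs. *)
Definition exchange f (t a : 'I_n) : {ffun 'I_n -> 'I_n} :=
  [ffun i => tperm a (f t) (f (tperm a (f t) i))].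

(** The arc from a closes at t or later, so the exchanged pairs are again arcs
with the same left and right ends, and no right end before t is involved. *)
Lemma exchangeP (t : 'I_n) f a : stable_inv f -> t \in D -> f t < t ->
  a \in open_arcs t f -> exchange f t a \in agree t f /\ exchange f t a t = a.
Proof.
rewrite mem_open_arcs => fP tD lt_t /and3P[aD at_ ge_t].
have fK := stable_invK fP; have fD := stable_invD fP.
have ne_at : t != a by rewrite -val_eqE /=; lia.
have ne_ct : t != f t by rewrite -val_eqE /=; lia.
have pD i : i != a -> i != f t -> tperm a (f t) i = i.
  by move=> ia ic; rewrite tpermD // eq_sym.
have ft : exchange f t a t = a by rewrite ffunE (pD t) // tpermR.
split=> //.
case: (eqVneq a (f t)) => [E|ne_ac].
  have -> : exchange f t a = f by apply/ffunP=> i; rewrite ffunE E tperm1 !perm1.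
  exact: agree_refl.
have fI := inj_eq (can_inj fK).
have fa_a : f a != a by rewrite -val_eqE /=; lia.
have fa_c : f a != f t by rewrite fI eq_sym.
have bt : f a != t by apply: contraNneq ne_ac => <-; rewrite fK.
have other i : i \notin [:: a; f t; t; f a] -> exchange f t a i = f i.
  rewrite !inE !negb_or => /and4P[ia ic it ib]; rewrite ffunE (pD i) // pD ?fI //.
  by apply: contra ib => /eqP <-; rewrite fK.
have fa : exchange f t a a = t by rewrite ffunE tpermL fK pD.
have fc : exchange f t a (f t) = f a by rewrite ffunE tpermR pD.
have fb : exchange f t a (f a) = f t by rewrite ffunE (pD (f a)) // fK tpermL.
have inD i : (tperm a (f t) i \in D) = (i \in D).
  by case: tpermP => // ->; rewrite ?fD ?tD aD.
apply/agreeP; split.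
- apply/andP; split; apply/forallP=> i; apply/eqP.
    by rewrite !ffunE tpermK fK tpermK.
  by rewrite ffunE inD fD inD.
- move=> i; rewrite /background; case: (boolP (i \in [:: a; f t; t; f a]));
  last by move/other->.
  have hlt : f t < f a := leq_trans lt_t ge_t.
  rewrite !inE => /or4P[]/eqP-> //; rewrite ?(fa, fc, fb, ft, fK) ?fD ?tD ?aD /=.
  + by rewrite ne_at fa_a at_ (leq_trans at_).
  + by rewrite ne_ct fa_c lt_t hlt.
  + rewrite !(eq_sym _ t) ne_at ne_ct; congr inl; clear -at_ ge_t lt_t; lia.
  + rewrite eq_sym fa_c eq_sym fa_a; congr inl; clear -at_ ge_t lt_t; lia.
- move=> i lt_i it; apply: other; rewrite !inE !negb_or; apply/and4P; split.
  + by apply: contraTneq lt_i => ->; clear -at_ ge_t; lia.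
  + by apply: contraTneq lt_i => ->; rewrite fK; clear -lt_t; lia.
  + by rewrite -val_eqE /=; clear -it; lia.
  + by apply: contraTneq it => ->; clear -ge_t; lia.
Qed.

(** * Tableaux of the arcs that straddle a position *)

(** The left ends of the arcs straddling t, by increasing right ends. Increasing
chains are families of mutually crossing arcs, decreasing chains are families
of nested arcs. *)
Definition pending_word t f :=
  [seq val (f j) | j <- drop t (enum 'I_n) & (j \in D) && (f j < t)].

Lemma drop_enum (t : 'I_n) : drop t (enum 'I_n) = t :: drop t.+1 (enum 'I_n).
Proof. by rewrite (drop_nth t) ?size_enum_ord ?ltn_ord // nth_ord_enum. Qed.

Lemma mem_drop_enum t j : (j \in drop t (enum 'I_n)) = (t <= j).
Proof.
have := enum_uniq 'I_n; rewrite -{1}(cat_take_drop t (enum 'I_n)) cat_uniq.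
move=> /and3P[_ /hasPn no _]; have je : j \in enum 'I_n by rewrite mem_enum.
have := in_take t je; rewrite index_enum_ord => take_j.
have := je; rewrite -{1}(cat_take_drop t (enum 'I_n)) mem_cat take_j (leqNgt t).
move/implyP: (no j); rewrite take_j.
by case: (j < t); case: (j \in drop _ _).
Qed.

Lemma pending_word_down (t : 'I_n) g : stable_inv g -> t \in D -> g t < t ->
  pending_word t g = val (g t) :: pending_word t.+1 g.
Proof.
move=> gP tD lt_t; rewrite /pending_word drop_enum /= tD lt_t /=;
  congr (_ :: map _ _).
apply: eq_in_filter => j; rewrite mem_drop_enum => tj; case: (j \in D) => //=.
rewrite ltnS (leq_eqVlt (g j)); case: eqP => // /val_inj gj.
by move: tj lt_t; rewrite -gj (stable_invK gP); lia.
Qed.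

Lemma pending_word_up (t : 'I_n) g : t < g t ->
  pending_word t g = filter (predC1 (val t)) (pending_word t.+1 g).
Proof.
move=> gt_t; rewrite /pending_word drop_enum /= ltnNge ltnW // andbF filter_map
  -filter_predI.
congr map; apply: eq_filter => j /=; rewrite andbCA; congr (_ && _).
by rewrite ltnS ltn_neqAle.
Qed.

Lemma pending_word_stay (t : 'I_n) g : stable_inv g ->
  ~~ ((t \in D) && (g t != t)) ->
  pending_word t g = pending_word t.+1 g.
Proof.
move=> gP stay; rewrite /pending_word drop_enum /=; have -> : (t \in D) &&
  (g t < t) = false.
  by apply: contraNF stay => /andP[->]; rewrite -val_eqE /=; lia.
congr map; apply: eq_in_filter => j; rewrite mem_drop_enum => tj.
case jD: (j \in D) => //=; rewrite ltnS (leq_eqVlt (g j));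
  case: eqP => // /val_inj gj.
case/negP: stay; rewrite -{1}gj (stable_invD gP) jD -gj (stable_invK gP) gj
  -val_eqE /=; lia.
Qed.

Lemma mem_pending_word t g (x : nat) :
  reflect (exists j, [/\ j \in D, t <= j, g j < t & x = g j :> nat])
  (x \in pending_word t g).
Proof.
apply: (iffP mapP) => [[j]|[j [jD tj lt_t ->]]].
  by rewrite mem_filter mem_drop_enum => /andP[/andP[jD lt_t] tj] ->; exists j.
by exists j; rewrite // mem_filter mem_drop_enum jD lt_t tj.
Qed.

Lemma pending_word_uniq t g : stable_inv g -> uniq (pending_word t g).
Proof.
move=> gP; rewrite map_inj_uniq ?filter_uniq ?drop_uniq ?enum_uniq // => i j
  /val_inj.
exact: (can_inj (stable_invK gP)).
Qed.

Lemma pending_word_open_arcs t g : stable_inv g ->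
  perm_eq (pending_word t g) (map val (open_arcs t g)).
Proof.
move=> gP; apply: uniq_perm; first exact: pending_word_uniq.
  by rewrite (map_inj_uniq val_inj) filter_uniq ?enum_uniq.
move=> x; apply/mem_pending_word/mapP => [[j [jD tj lt_t ->]]|[i]].
  by exists (g j); rewrite // mem_open_arcs (stable_invD gP) jD lt_t
    (stable_invK gP).
rewrite mem_open_arcs => /and3P[iD it ge_t] ->; exists (g i).
by rewrite (stable_invD gP) (stable_invK gP).
Qed.

Lemma step_of_agree t f g : g \in agree t f -> step_of g =1 step_of f.
Proof. by case/agreeP=> _ gkey _ i; rewrite /step_of gkey. Qed.

Lemma steps_agree t f g : g \in agree t f -> steps g = steps f.
Proof. by move=> gf; apply: eq_map => i; exact: step_of_agree gf i. Qed.

Lemma drop_steps (t : 'I_n) f : drop t (steps f) = step_of f t :: drop t.+1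
  (steps f).
Proof. by rewrite /steps -map_drop drop_enum /= map_drop. Qed.

Lemma size_pending_word t g : size (pending_word t g) <= n.
Proof.
rewrite size_map size_filter (leq_trans (count_size _ _)) //.
by rewrite size_drop size_enum_ord leq_subr.
Qed.

Lemma rs_tableau_pending_up (t : 'I_n) g : stable_inv g -> t \in D -> t < g t ->
  exists r, rs_tableau (pending_word t.+1 g) = (val t, r) :: rs_tableau
    (pending_word t g).
Proof.
move=> gP tD up; rewrite pending_word_up //; apply: rs_tableau_max;
  first exact: pending_word_uniq.
  by apply/mem_pending_word; exists (g t);
    rewrite (stable_invD gP) (stable_invK gP).
by apply/allP => x /mem_pending_word[j [_ _ lt_t ->]].
Qed.

Lemma step_ofP f i :
  match step_of f i with
  | Up => i \in D /\ i < f i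
  | Down => i \in D /\ f i < i
  | Dot => i \in D /\ f i = i
  | Idle => i \notin D
  end.
Proof.
rewrite /step_of /background; case: (boolP (i \in D)) => //= iD.
case: eqVneq => [//|ne] /=; case: ltnP => // le_i; split=> //.
by rewrite ltn_neqAle le_i andbT.
Qed.

Section ShapeCount.
Variables r0 c0 : nat.

(** With (r0, c0) = (k, 0) this bounds the numbers of rows by k, with (0, k) those
of columns. *)
Definition shapes_avoid t f :=
  [forall s : 'I_n.+1, (t <= s) ==> (row_len (rs_tableau (pending_word s f)) r0 <=
    c0)].

Definition shaped t f (q : tableau) :=
  [set g in agree t f | (rs_tableau (pending_word t g) == q) && shapes_avoid t g].

Lemma shapes_avoidS (t : 'I_n) f :
  shapes_avoid t f = (row_len (rs_tableau (pending_word t f)) r0 <= c0) &&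
    shapes_avoid t.+1 f.
Proof.
apply/forallP/andP => [tf|[ht /forallP tf] s].
  split; first by have := tf (widen_ord (leqnSn n) t); rewrite /= leqnn.
  by apply/forallP => s; apply/implyP => /ltnW ts; apply: implyP ts.
apply/implyP; rewrite leq_eqVlt => /orP[/eqP<- //|].
exact/implyP.
Qed.

(** The involutions that share the past of f and have the tableau q at t are
counted by walks starting at the shape of q. If an arc opens at t, the new
largest entry may go to any outer_corner corner. If an arc closes at t, choosing
the corner that disappears determines by reverse insertion both the next tableau
and the entry a that leaves it, and the exchange lemma supplies an involution in
which the arc from a closes at t. So the number of continuations does not
depend on q but only on its shape. *)
Lemma card_shaped d t f q : t + d = n -> stable_inv f -> is_tableau q ->
  decreasing q -> perm_eq (unzip1 q) (map val (open_arcs t f)) ->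
  #|shaped t f q| = shape_walks r0 c0 n.+1 (drop t (steps f)) (diagram q).
Proof.
elim: d t f q => [|d IH] t f q.
  rewrite addn0 => -> {t} fP tq dq.
  have -> : open_arcs n f = [::].
    apply/eqP; rewrite -[_ == _]negbK -has_filter; apply/hasPn => i _.
    by rewrite (leqNgt n) !ltn_ord /= andbF.
  case: q tq dq => [_ _ _|y q _ _ /perm_size //].
  have pending_word_n g : pending_word n g = [::] by rewrite /pending_word
    drop_oversize ?size_enum_ord.
  have size_steps : size (steps f) = n by rewrite size_map size_enum_ord.
  rewrite drop_oversize ?size_steps //= /diagram /=.
  have -> : shaped n f [::] = [set f]; last by rewrite cards1.
  apply/setP=> g; rewrite in_set agree_all // in_set1 pending_word_n eqxx /=.
  rewrite andb_idr // => _; apply/forallP => s; apply/implyP => ns.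
  by rewrite (_ : val s = n) ?pending_word_n //; apply/eqP;
    rewrite eqn_leq ns -ltnS ltn_ord.
rewrite -addSnnS => tn fP tq dq pq.
have lt_tn : t < n by lia.
set t' := Ordinal lt_tn; have IHt := IH _ _ _ tn.
rewrite -[t]/(val t') drop_steps /=.
case: ifP => [bad|/negbT good].
  apply: eq_card0 => g; rewrite in_set -[t]/(val t') shapes_avoidS; apply/negP.
  by move=> /andP[_ /andP[/eqP-> /andP[]]]; rewrite leqNgt; move: bad;
    rewrite /diagram => ->.
have shapedE g : (g \in shaped t f q) =
    [&& g \in agree t f, rs_tableau (pending_word t g) == q & shapes_avoid t.+1 g].
  rewrite in_set -[t]/(val t') shapes_avoidS; case: eqP => [->|];
    last by rewrite !andbF.
  by move: good; rewrite /diagram -leqNgt => ->.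
have stay : ~~ ((t' \in D) && (f t' != t')) -> #|shaped t f q| =
    shape_walks r0 c0 n.+1 (drop t'.+1 (steps f)) (diagram q).
  move=> stay; have -> : shaped t f q = shaped t'.+1 f q.
    apply/setP=> g; rewrite shapedE [RHS]in_set agree_stay; last first.
      by apply: contra stay => /andP[->]; apply: contraTneq => ->; rewrite ltnn.
    case gf: (g \in agree t f) => //=; have /agreeP[gP gkey _] := gf.
    rewrite -[t]/(val t') (@pending_word_stay t') //.
    by rewrite (background_fix (gkey t') stay).
  apply: IHt => //; apply: perm_trans pq _.
  rewrite -(permPl (pending_word_open_arcs t fP)) -[t]/(val t')
    (@pending_word_stay t') //.
  exact: pending_word_open_arcs.
have le_n : size q <= n.
  by rewrite -(size_map fst) (perm_size pq)
    -(perm_size (pending_word_open_arcs t fP)) size_pending_word.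
have := step_ofP f t'; case: (step_of f t') => [[tD up]|[tD down]|[tD fix_t]|tnD].
- have up_g g : g \in agree t f -> stable_inv g /\ t' < g t'.
    by case/agreeP=> gP gkey _; rewrite (background_lt (gkey t')).
  rewrite (@card_by_value _ _ (fun g =>
    (head (0, 0) (rs_tableau (pending_word t'.+1 g))).2) n.+1).
    apply: eq_bigr => r _; rewrite (@sum_outer q r _ (fun c : nat =>
      shape_walks r0 c0 n.+1 (drop t'.+1 (steps f)) (add_cell (diagram q) r c)));
      last by rewrite ltnS (leq_trans (count_size _ _)).
    have rs_f g : g \in agree t f -> exists r, rs_tableau (pending_word t'.+1 g) =
      (val t', r) :: rs_tableau (pending_word t g).
      by move=> gf; have [gP gt_t] := up_g g gf; exact: rs_tableau_pending_up.
    case: ifP => [add|not_add]; last first.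
      apply: eq_card0 => g; rewrite in_set shapedE; apply/negP.
      move=> /andP[/and3P[gf /eqP rs_g _] /eqP hg].
      have [r' rs_g'] := rs_f g gf; rewrite rs_g' /= in hg.
      by have := is_tableau_rs_tableau (pending_word t'.+1 g);
        rewrite rs_g' rs_g hg /= not_add.
    rewrite (eq_shape_walks _ _ _ _ (diagram_add q (val t') r)).
    rewrite -IHt //=; last 3 first.
    - by rewrite add.
    - rewrite decreasing_cons dq andbT (perm_all _ pq); apply/allP=> x /mapP[i].
      by rewrite mem_open_arcs => /and3P[_ it _] ->.
    - rewrite -(permPr (pending_word_open_arcs t.+1 fP))
      -(permPr (perm_rs_tableau _)).
      have [r' -> /=] := rs_f f (agree_refl t fP); rewrite perm_cons.
      rewrite (permPl pq) (permPr (perm_rs_tableau _)) perm_sym;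
        exact: pending_word_open_arcs.
    apply: eq_card => g; rewrite in_set shapedE [RHS]in_set.
    rewrite -[t.+1]/(t'.+1) agree_stay; last by rewrite ltnNge (ltnW up) andbF.
    case gf: (g \in agree t f) => //=; have [r' ->] := rs_f g gf.
    by rewrite eqseq_cons xpair_eqE eqxx /= andbAC -andbA andbCA andbA.
  move=> g; rewrite shapedE => /and3P[gf /eqP rs_g _]; have [gP gt_t] := up_g g gf.
  have [r rs_g'] := rs_tableau_pending_up gP tD gt_t; rewrite rs_g' /=.
  have := is_tableau_rs_tableau (pending_word t'.+1 g); rewrite rs_g' => tg.
  have := tableau_row_lt (r := r) tg; rewrite {1}/row_len /= eqxx => /(_ isT).
  by move/leq_trans; apply; rewrite ltnS -[t]/(val t') rs_g.
- have down_g g : g \in agree t f -> stable_inv g /\ pending_word t g =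
  val (g t') :: pending_word t'.+1 g.
    case/agreeP=> gP gkey _; split=> //; apply: (@pending_word_down t') => //.
    by rewrite (background_lt (gkey t')).
  rewrite (@card_by_value _ _ (fun g =>
    (row_insert (g t') (rs_tableau (pending_word t'.+1 g))).1) n.+1).
    apply: eq_bigr => c _; rewrite (@sum_inner q c _ (fun k =>
      shape_walks r0 c0 n.+1 (drop t'.+1 (steps f)) (del_cell (diagram q) c k)));
      last by rewrite (leq_trans (count_size _ _)) // ltnW.
    case: ltnP => [corner|no_corner]; last first.
      apply: eq_card0 => g; rewrite in_set shapedE; apply/negP.
      move=> /andP[/and3P[gf /eqP rs_g _] /eqP hg].
      have [gP wg] := down_g g gf; rewrite wg /= in rs_g.
      have := row_len_row_insert (g t') (rs_tableau (pending_word t'.+1 g)).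
      rewrite rs_g hg => len_q; have := is_tableau_row_len c
        (is_tableau_rs_tableau (pending_word t'.+1 g)).
      by move: no_corner; rewrite !len_q eqxx; clear; lia.
    have [[a q'] ev /= [tq' len_q]] := row_evict_corner tq corner.
    have ins := row_insert_evict dq ev.
    have pq' : perm_eq (unzip1 q) (a :: unzip1 q').
      by have := perm_row_insert a q'; rewrite ins.
    (* The evicted entry is the left end of an open arc, which can close at t. *)
    have: a \in map val (open_arcs t f).
      by rewrite -(perm_mem pq) (perm_mem pq') inE eqxx.
    case/mapP=> a' a'o Ea.
    have [f'f f't] := exchangeP fP tD down a'o; set f' :=
      exchange f t' a' in f'f f't.
    have f'P : stable_inv f' by case/agreeP: f'f.
    have lt_a : f' t' < t' by rewrite f't; move: a'o;
      rewrite mem_open_arcs => /and3P[].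
    rewrite -(steps_agree f'f) (eq_shape_walks _ _ _ _ (diagram_del len_q)).
    rewrite -IHt //; last 2 first.
    - have := subseq_row_insert a q'; rewrite ins /=; move/subseq_sorted;
      apply=> //.
      exact: gtn_trans.
    - rewrite -(perm_cons a) -(permPl pq') (permPl pq) -(open_arcs_agree fP f'f).
      rewrite -(permPl (pending_word_open_arcs _ f'P)) (down_g f' f'f).2 f't -Ea
        perm_cons.
      exact: pending_word_open_arcs.
    apply: eq_card => g; rewrite in_set shapedE [RHS]in_set.
    rewrite -[t.+1]/(t'.+1) (agree_step _ f'f) // f't.
    case gf: (g \in agree t f) => //=; have [gP wg] := down_g g gf; rewrite wg /=.
    rewrite -andbA andbCA [RHS]andbA [RHS]andbC; congr (_ && _).
    apply/andP/andP => -[/eqP e1 /eqP e2].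
      have := row_evict_insert (g t') (rs_tableau (pending_word t'.+1 g));
        rewrite e1 e2 ev.
      by case=> Eg ->; rewrite -val_eqE -[X in _ == X]Ea Eg !eqxx.
    by rewrite e1 e2 -Ea ins.
  move=> g; rewrite shapedE => /and3P[gf /eqP rs_g _]; have [gP wg] := down_g g gf.
  have := row_len_row_insert (g t') (rs_tableau (pending_word t'.+1 g)).
  rewrite wg /= in rs_g; rewrite rs_g; set c := (row_insert _ _).1 => len_q.
  have := tableau_row_lt (r := c) tq; rewrite len_q eqxx addn1 => /(_ isT).
  by move/leq_trans; apply; rewrite ltnW.
- by apply: stay; rewrite fix_t eqxx andbF.
- by apply: stay; rewrite (negPf tnD).
Qed.

Lemma card_shapes_avoid f : stable_inv f ->
  #|[set g in agree 0 f | shapes_avoid 0 g]| = shape_walks r0 c0 n.+1 (steps f)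
    (fun _ _ => false).
Proof.
move=> fP; have pending_word0 g : pending_word 0 g = [::].
  apply/eqP; case E: (pending_word 0 g) => [|x w] //.
  by have /mem_pending_word[j []] : x \in pending_word 0 g by rewrite E inE eqxx.
have open_arcs0 : open_arcs 0 f = [::].
  apply/eqP; rewrite -[_ == _]negbK -has_filter; apply/hasPn => i _.
  by rewrite ltn0 andbF.
have := @card_shaped n 0 f [::] (add0n _) fP isT isT.
rewrite open_arcs0 drop0 => /(_ isT) <-.
by apply: eq_card => g; rewrite !in_set pending_word0 eqxx.
Qed.

End ShapeCount.

(** * Open arcs that cover a point *)

Section Cover.
Variables (dots crossing : bool).

(** An arc from a that is open at t covers the point i. Because of f i < t this
depends only on the part of f before t. Fixed points count if dots is set. *)
Definition covers t f a :=
  [exists i, [&& i \in D, a < i, i <= f i, f i < t & dots || (f i != i)]].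

(** The arc that closes at t completes a forbidden pair with an arc from b that is
still open; of these two arcs, the one starting further to the right has to
cover the common point, and then so does the other. *)
Definition bad_closure (t : 'I_n) f :=
  [&& t \in D, f t < t & [exists b in open_arcs t f,
    if crossing then (f t < b) && covers t f b else (b < f t) && covers t f (f t)]].

Definition no_bad_closure t f := [forall s : 'I_n, (t <= s) ==> ~~ bad_closure s f].

(** Here m counts the open arcs and y those among them that cover a point. The
closing step is explained by closing_walks_down. *)
Fixpoint closing_walks (st : seq step) m y :=
  match st with
  | [::] => 1
  | Up :: st' => closing_walks st' m.+1 y
  | Down :: st' => (if y is y'.+1 then closing_walks st' m.-1 y' else 0) +
                   \sum_(y <= p < m) closing_walks st' m.-1 p
  | Dot :: st' => closing_walks st' m (if dots then m else y)
  | Idle :: st' => closing_walks st' m y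
  end.

Lemma covers_mono t f a b : a <= b -> covers t f b -> covers t f a.
Proof.
move=> ab /existsP[i /and5P[iD bi ? ? ?]]; apply/existsP; exists i.
by apply/and5P; split=> //; exact: leq_ltn_trans bi.
Qed.

Lemma covers_agree t f g : stable_inv f -> g \in agree t f ->
  covers t g =1 covers t f.
Proof.
move=> fP gf a; have gP : stable_inv g by case/agreeP: gf.
apply/existsP/existsP => -[i /and5P[iD ai le_i lt_t ne]]; exists i;
  have it := leq_ltn_trans le_i lt_t.
  by rewrite (agree_below gP (agree_sym fP gf)) //; apply/and5P.
by rewrite (agree_below fP gf) //; apply/and5P.
Qed.

Lemma coversS (t : 'I_n) f a : stable_inv f -> covers t.+1 f a = covers t f a ||
  [&& t \in D, f t <= t, a < f t & dots || (f t != t)].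
Proof.
move=> fP; apply/existsP/orP => [[i /and5P[iD ai le_i]]|[/existsP[i]|]].
- rewrite ltnS (leq_eqVlt (f i)) => /orP[/eqP/val_inj fi|lt_t] ne; last first.
    by left; apply/existsP; exists i; apply/and5P.
  by right; rewrite -fi (stable_invK fP) (stable_invD fP) iD le_i ai eq_sym.
- by case/and5P=> iD ai le_i lt_t ne; exists i; rewrite iD ai le_i ne ltnW.
- case/and4P=> tD le_t at_ ne; exists (f t).
  by rewrite (stable_invD fP) (stable_invK fP) tD le_t at_ ltnS leqnn eq_sym.
Qed.

(** The forbidden values of the number p of open arcs to the left of the one that
closes. *)
Definition bad_rank p y := if crossing then p.+1 < y else (p < y) && (0 < p).

(** Of the y choices p < y only one is admissible, the leftmost arc for nested pairs
and the rightmost covering arc for crossing pairs. Both lead to y - 1. *)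
Lemma closing_walks_down st m y : y <= m ->
  \sum_(p < m) (if bad_rank p y then 0 else closing_walks st m.-1
    (if p < y then y.-1 else p))
  = closing_walks (Down :: st) m y.
Proof.
move=> ym; rewrite -(big_mkord xpredT (fun p =>
  if bad_rank p y then 0 else closing_walks st m.-1 (if p < y then y.-1 else p))).
rewrite (@big_cat_nat _ _ _ y) //=; congr (_ + _); last first.
  apply: eq_big_nat => p /andP[yp _]; rewrite /bad_rank (ltnNge p) yp /=.
  by case: crossing => //; case: ltnP => //; lia.
case: y ym => [|y] ym; first by rewrite big_geq.
rewrite /bad_rank; case: crossing.
  rewrite big_nat_recr //= ltnn ltnSn big_nat big1 ?add0n // => p /andP[_ py].
  by rewrite ltnS py.
rewrite big_nat_recl //= big_nat big1 ?addn0 // => p /andP[_ py].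
by rewrite ltnS py.
Qed.

Definition rank a (o : seq 'I_n) := count (fun b => b < a) o.

Lemma rank_lt a o : a \in o -> rank a o < size o.
Proof.
move=> ao; rewrite /rank -(count_predC (fun b => b < a) o) -[X in X < _]addn0
  ltn_add2l.
by rewrite -has_count; apply/hasP; exists a; rewrite //= ltnn.
Qed.

Lemma rank_surj o p : sorted ltn (map val o) -> p < size o ->
  exists2 a, a \in o & rank a o = p.
Proof.
move=> so; elim: o p so => [|x o IH] // [|p]; rewrite [map _ _]/= /= path_sortedE;
  try exact: ltn_trans; case/andP=> lt_x so.
  exists x; rewrite ?inE ?eqxx // /rank /= ltnn; apply/eqP.
  rewrite -leqn0 leqNgt -has_count; apply/hasPn => b bo.
  by rewrite -leqNgt ltnW //; apply: (allP lt_x); exact: map_f.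
move=> lt_p; have [a ao <-] := IH p so lt_p; exists a; first by rewrite inE ao orbT.
by rewrite /rank /=; have /= -> := allP lt_x _ (map_f _ ao).
Qed.

Lemma sorted_open_arcs t f : sorted ltn (map val (open_arcs t f)).
Proof.
rewrite sorted_map; apply: sorted_filter; first by move=> y x z; exact: ltn_trans.
by rewrite -sorted_map val_enum_ord iota_ltn_sorted.
Qed.

Lemma open_arcs_uniq t f : uniq (open_arcs t f).
Proof. by rewrite filter_uniq ?enum_uniq. Qed.

Lemma stable_inv_val f a b : stable_inv f -> f a = b :> nat -> a = f b :> nat.
Proof. by move=> fP /val_inj <-; rewrite (stable_invK fP). Qed.

Lemma open_arcs_up (t : 'I_n) f : stable_inv f -> t \in D -> t < f t ->
  perm_eq (open_arcs t.+1 f) (t :: open_arcs t f).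
Proof.
move=> fP tD up; apply: uniq_perm;
  rewrite /= ?open_arcs_uniq ?mem_open_arcs ?ltnn ?andbF // => a.
rewrite inE !mem_open_arcs ltnS; case: (eqVneq a t) => [->|ne];
  first by rewrite tD leqnn up.
case: (a \in D) => //=; rewrite -val_eqE /= in ne.
have := @stable_inv_val f a t fP; lia.
Qed.

Lemma open_arcs_down (t : 'I_n) f : stable_inv f -> t \in D -> f t < t ->
  perm_eq (open_arcs t f) (f t :: open_arcs t.+1 f).
Proof.
move=> fP tD down; apply: uniq_perm;
  rewrite /= ?open_arcs_uniq ?mem_open_arcs ?(stable_invK fP) ?ltnn ?andbF // => a.
rewrite inE !mem_open_arcs; case: (eqVneq a (f t)) => [->|ne].
  by rewrite (stable_invK fP) (stable_invD fP) tD down leqnn.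
case aD: (a \in D) => //=; case: (eqVneq a t) => [->|ne_t]; first by lia.
rewrite -!val_eqE /= in ne ne_t; have := @stable_inv_val f a t fP; lia.
Qed.

Lemma open_arcs_stay (t : 'I_n) f : stable_inv f -> ~~ ((t \in D) && (f t != t)) ->
  perm_eq (open_arcs t f) (open_arcs t.+1 f).
Proof.
move=> fP stay; apply: uniq_perm; rewrite /= ?open_arcs_uniq // => a;
  rewrite !mem_open_arcs.
case aD: (a \in D) => //=; case: (eqVneq a t) => [at_|ne].
  by move: stay; rewrite -at_ aD /= negbK => /eqP->; lia.
have fa_t : f a != t.
  apply: contraNneq stay => fa; rewrite -{1}fa (stable_invD fP) aD -{1}fa
    (stable_invK fP) //.
rewrite -!val_eqE /= in ne fa_t; lia.
Qed.

Definition ranked t f := count (covers t f) (open_arcs t f).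

Lemma rank_mono a b o : a \in o -> a < b -> rank a o < rank b o.
Proof.
move=> ao ab; apply: (count_lt (x := a)); rewrite ?ltnn //.
by move=> c /ltn_trans; apply.
Qed.

Lemma rank_eq a b o : a \in o -> b \in o -> (rank a o == rank b o) = (a == b).
Proof.
move=> ao bo; apply/eqP/eqP => [rk|-> //]; apply: val_inj.
by case: (ltngtP a b) => // /(rank_mono _); [move/(_ _ ao)|move/(_ _ bo)];
  rewrite rk ltnn.
Qed.

(** An arc further to the left covers more, so the covering arcs are the leftmost
open ones. *)
Lemma covers_rank t f a : a \in open_arcs t f ->
  covers t f a = (rank a (open_arcs t f) < ranked t f).
Proof.
move=> ao; apply/idP/idP => [cov|].
  apply: leq_trans (count_lt (Q := fun b => b <= a) _ ao _ _) _; rewrite ?ltnn //.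
    by move=> b /ltnW.
  by apply: sub_count => b /= /covers_mono; apply.
rewrite ltnNge; apply: contraR => ncov; apply: sub_count => b /= cov.
by rewrite ltnNge; apply: contra ncov => ab; exact: covers_mono cov.
Qed.

Lemma bad_closure_rank (t : 'I_n) f : stable_inv f -> t \in D -> f t < t ->
  bad_closure t f = bad_rank (rank (f t) (open_arcs t f)) (ranked t f).
Proof.
move=> fP tD down; rewrite /bad_closure tD down /= /bad_rank.
have ao : f t \in open_arcs t f by rewrite mem_open_arcs (stable_invD fP)
  (stable_invK fP) tD down leqnn.
case: crossing.
  apply/existsP/idP => [[b /andP[bo /andP[lt_b]]]|lt_r].
    by rewrite covers_rank //; apply: leq_trans; rewrite ltnS rank_mono.
  apply/existsP; apply: contraLR lt_r => /existsPn no; rewrite -leqNgt /ranked.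
  apply: (@leq_trans (count (fun b => b <= f t) (open_arcs t f))).
    apply: sub_in_count => b bo cov; rewrite leqNgt; apply: contra (no b) => lt_b.
    by rewrite bo lt_b.
  rewrite (@eq_count _ _ (predU (fun b => b < f t) (pred1 (f t)))); last first.
    by move=> b /=; rewrite leq_eqVlt orbC.
  rewrite -(leq_add2r (count (predI (fun b => b < f t) (pred1 (f t)))
    (open_arcs t f))).
  rewrite count_predUI count_uniq_mem ?open_arcs_uniq // ao addn1; exact: leq_addr.
rewrite -covers_rank //; case: (covers t f (f t)) => /=.
  rewrite /rank -has_count; apply/existsP/hasP =>
    [[b /andP[bo /andP[lt_b _]]]|[b bo lt_b]].
    by exists b.
  by exists b; rewrite bo lt_b.
by apply/existsP => -[b /and3P[]].
Qed.

(** The arcs to the left of the one that closes now cover its left end. *)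
Lemma ranked_down (t : 'I_n) f : stable_inv f -> t \in D -> f t < t ->
  ranked t.+1 f = if rank (f t) (open_arcs t f) < ranked t f then (ranked t f).-1
                  else rank (f t) (open_arcs t f).
Proof.
move=> fP tD down; have fixD : f t != t by rewrite -val_eqE /=; lia.
have ao : f t \in open_arcs t f by rewrite mem_open_arcs (stable_invD fP)
  (stable_invK fP) tD down leqnn.
have cov b : covers t.+1 f b = covers t f b || (b < f t).
  by rewrite coversS // tD (ltnW down) fixD orbT andbT.
have po := open_arcs_down fP tD down.
rewrite -covers_rank //; case cov_t: (covers t f (f t)).
  rewrite /ranked (seq.permP po) /= cov_t add1n /=; apply: eq_count => b;
    rewrite cov.
  by apply: orb_idr => /ltnW /covers_mono; apply.
rewrite /rank (seq.permP po) /= ltnn add0n; apply: eq_count => b; rewrite cov.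
apply: orb_idl => cov_b; rewrite ltnNge; apply: contraFN cov_t => le_b.
exact: covers_mono cov_b.
Qed.

Lemma no_bad_closureS (t : 'I_n) f : no_bad_closure t f = ~~ bad_closure t f &&
  no_bad_closure t.+1 f.
Proof.
apply/forallP/andP => [tf|[ht /forallP tf] s].
  split; first by have := tf t; rewrite leqnn.
  by apply/forallP => s; apply/implyP => /ltnW ts; apply: implyP ts.
apply/implyP; rewrite leq_eqVlt => /orP[/eqP/val_inj<- //|].
exact/implyP.
Qed.

Lemma ranked_le t f : ranked t f <= size (open_arcs t f).
Proof. exact: count_size. Qed.

Lemma bad_closure_down (t : 'I_n) f : ~~ ((t \in D) && (f t < t)) ->
  bad_closure t f = false.
Proof. by rewrite /bad_closure; case: (t \in D) => //= /negPf->. Qed.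

(** The recursion does not mention which kind of pair is forbidden, so nested and
crossing pairs give the same number. *)
Lemma card_no_bad_closure d t f : t + d = n -> stable_inv f ->
  #|[set g in agree t f | no_bad_closure t g]| =
  closing_walks (drop t (steps f)) (size (open_arcs t f)) (ranked t f).
Proof.
elim: d t f => [|d IH] t f.
  rewrite addn0 => -> {t} fP.
  have size_steps : size (steps f) = n by rewrite size_map size_enum_ord.
  rewrite drop_oversize ?size_steps //= (_ : [set _ in _ | _] = [set f]) ?cards1 //.
  apply/setP=> g; rewrite in_set agree_all // in_set1 andb_idr // => _.
  by apply/forallP => s; rewrite leqNgt ltn_ord.
rewrite -addSnnS => tn fP; have lt_tn : t < n by lia.
have [t' Et] : exists t' : 'I_n, t = t' by exists (Ordinal lt_tn).
rewrite {}Et {t lt_tn} in tn *; rewrite drop_steps.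
have IHt := IH t'.+1 _ tn.
have no_down : ~~ ((t' \in D) && (f t' < t')) ->
    #|[set g in agree t' f | no_bad_closure t' g]| =
    closing_walks (drop t'.+1 (steps f)) (size (open_arcs t'.+1 f))
      (ranked t'.+1 f).
  move=> nd; rewrite -IHt // agree_stay //; apply: eq_card => g;
    rewrite in_set [RHS]in_set.
  case gf: (g \in agree t' f) => //=; rewrite no_bad_closureS bad_closure_down //.
  by case/agreeP: gf => _ gkey _; rewrite (background_lt (gkey t')).
have := step_ofP f t'; case: (step_of f t') => [[tD up]|[tD down]|[tD fix_t]|tnD]
  /=.
- rewrite no_down ?(ltnNge (f t')) ?(ltnW up) ?andbF //
  (perm_size (open_arcs_up fP tD up)).
  congr closing_walks; rewrite /ranked (seq.permP (open_arcs_up fP tD up)) /=.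
  have cov b : covers t'.+1 f b = covers t' f b.
    by rewrite coversS // leqNgt up andbF orbF.
  rewrite cov (eq_count cov) (_ : covers t' f t' = false) //.
  by apply/negbTE/existsP => -[i /and5P[_ ti le_i lt_t _]]; lia.
- rewrite -/(closing_walks (Down :: drop t'.+1 (steps f)) (size (open_arcs t' f))
  (ranked t' f)).
  rewrite -closing_walks_down ?ranked_le //.
  have down_g g : g \in agree t' f ->
      [/\ stable_inv g, g t' < t', open_arcs t' g = open_arcs t' f & ranked t' g =
        ranked t' f].
    move=> gf; have /agreeP[gP gkey _] := gf; have o_g := open_arcs_agree fP gf.
    rewrite (background_lt (gkey t')) o_g; split=> //; rewrite /ranked o_g.
    exact/eq_count/covers_agree.
  rewrite (@card_by_value _ _ (fun g => rank (g t') (open_arcs t' f))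
    (size (open_arcs t' f))).
    apply: eq_bigr => p _; case: ifP => [bad|not_bad].
      apply: eq_card0 => g; rewrite in_set andbC in_set no_bad_closureS; apply/negP.
      move=> /andP[/eqP rk /andP[gf /andP[+ _]]].
      have [gP lt_t o_g r_g] := down_g g gf.
      by rewrite bad_closure_rank // o_g r_g rk bad.
    have [a ao rk] := rank_surj (sorted_open_arcs t' f) (ltn_ord p).
    have [f'f f't] := exchangeP fP tD down ao; set f' := exchange f t' a in f'f f't.
    have [f'P lt_a o_f' r_f'] := down_g f' f'f.
    have := ranked_down f'P tD lt_a; rewrite o_f' r_f' f't rk => <-.
    rewrite -(steps_agree f'f).
    have -> : (size (open_arcs t' f)).-1 = size (open_arcs t'.+1 f').
      by rewrite -o_f' (perm_size (open_arcs_down f'P tD lt_a)).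
    rewrite -IHt //; apply: eq_card => g;
      rewrite [RHS]in_set (agree_step _ f'f) // in_set andbC in_set no_bad_closureS.
    case gf: (g \in agree t' f); rewrite ?andbF //=.
    have [gP lt_t o_g r_g] := down_g g gf;
      rewrite bad_closure_rank // o_g r_g f't -rk.
    have -> : (rank (g t') (open_arcs t' f) == rank a (open_arcs t' f)) =
      (g t' == a).
      apply: rank_eq ao; by rewrite -o_g mem_open_arcs (stable_invD gP)
        (stable_invK gP) tD lt_t leqnn.
    by case: eqP => [->|//]; rewrite rk not_bad.
  move=> g; rewrite in_set => /andP[gf _]; have [gP lt_t o_g _] := down_g g gf.
  by apply: rank_lt; rewrite -o_g mem_open_arcs (stable_invD gP) (stable_invK gP)
    tD lt_t leqnn.
- have o_stay : perm_eq (open_arcs t' f) (open_arcs t'.+1 f).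
    by apply: open_arcs_stay; rewrite // fix_t eqxx andbF.
  rewrite no_down ?fix_t ?ltnn ?andbF // -(perm_size o_stay); congr closing_walks.
  rewrite /ranked -(seq.permP o_stay); have cov b : b \in open_arcs t' f ->
      covers t'.+1 f b = covers t' f b || dots.
    rewrite mem_open_arcs => /and3P[_ lt_b _].
    by rewrite coversS // tD fix_t leqnn lt_b eqxx orbF.
  rewrite (eq_in_count cov); case: (dots).
    by rewrite (eq_count (a2 := predT)) ?count_predT // => b; rewrite orbT.
  by apply: eq_count => b; rewrite orbF.
- have stay : ~~ ((t' \in D) && (f t' != t')) by rewrite (negPf tnD).
  rewrite no_down ?(negPf tnD) // (perm_size (open_arcs_stay fP stay));
    congr closing_walks.
  rewrite /ranked (seq.permP (open_arcs_stay fP stay)); apply: eq_count => b.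
  by rewrite coversS // (negPf tnD) orbF.
Qed.

End Cover.

(** * Nested and crossing arcs *)

(** The classes of equal background partition the involutions, and agree 0 f is
the class of f. *)
Lemma card_inv_classes (P Q : pred {ffun 'I_n -> 'I_n}) :
  (forall f, stable_inv f -> #|[set g in agree 0 f | P g]| =
    #|[set g in agree 0 f | Q g]|) ->
  #|[set g | stable_inv g & P g]| = #|[set g | stable_inv g & Q g]|.
Proof.
move=> eqPQ; pose K g := [ffun i => background g i].
rewrite -!sum1_card !(partition_big K predT) //=; apply: eq_bigr => k _.
case: (pickP (fun f => stable_inv f && (K f == k))) => [f /andP[fP /eqP <-]|none].
  have agreeE R : \sum_(g in [set g | stable_inv g & R g] | K g == K f) 1
                = #|[set g in agree 0 f | R g]|.
    rewrite -sum1_card; apply: eq_bigl => g; rewrite in_set [RHS]in_set andbAC.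
    congr (_ && _); apply/andP/agreeP => [[gP /eqP/ffunP Kg]|[gP gkey _]];
      split=> //.
      by move=> i; have := Kg i; rewrite !ffunE.
    by apply/eqP/ffunP=> i; rewrite !ffunE gkey.
  by rewrite !agreeE eqPQ.
by rewrite !big_pred0 // => g; rewrite in_set; have := none g;
  case: (stable_inv g) => //= ->;
  rewrite andbF.
Qed.

Definition arc_pattern (R : 'I_n -> 'I_n -> 'I_n -> bool) :=
  [exists a in D, exists b in D, exists c in D, R a b c].

Lemma arc_patternP (R : 'I_n -> 'I_n -> 'I_n -> bool) :
  reflect (exists a b c, [/\ a \in D, b \in D, c \in D & R a b c]) (arc_pattern R).
Proof.
apply: (iffP existsP) => [[a /andP[aD
  /existsP[b /andP[bD /existsP[c /andP[cD Rabc]]]]]]|].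
  by exists a, b, c.
case=> a [b [c [aD bD cD Rabc]]]; exists a; rewrite aD; apply/existsP.
by exists b; rewrite bD; apply/existsP; exists c; rewrite cD.
Qed.

(** Two nested arcs from a and b that cover the point c. If dots is false, then c
starts an arc as well, and the three arcs are nested. *)
Definition nesting dots f a b c :=
  [&& a < b, b < c, c <= f c, dots || (f c != c), f c < f b & f b < f a].
Definition crossing_over dots f a b c :=
  [&& a < b, b < c, c <= f c, dots || (f c != c), f c < f a & f a < f b].
Definition crossing3 f a b c := [&& a < b, b < c, c < f a, f a < f b & f b < f c].

(** The pair is complete when its inner arc closes. *)
Lemma no_bad_closure_nesting dots f : stable_inv f ->
  no_bad_closure dots false 0 f = ~~ arc_pattern (nesting dots f).
Proof.
move=> fP; apply/forallP/idP => [ok|].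
  apply/arc_patternP => -[a [b [c [aD bD cD /and5P[ab bc le_c ne /andP[cb ba]]]]]].
  have /negP := ok (f b); apply; rewrite /bad_closure (stable_invK fP)
    (stable_invD fP) bD /=.
  have b_b : b < f b by lia.
  have a_b : a < f b by lia.
  rewrite b_b; apply/existsP; exists a; rewrite mem_open_arcs aD a_b ltnW //= ab /=.
  by apply/existsP; exists c; apply/and5P.
move=> no s; apply/implyP => _; apply: contra no.
case/and3P=> sD lt_s /existsP[a /and3P[ao lt_a
  /existsP[c /and5P[cD lt_c le_c c_s ne]]]].
apply/arc_patternP; exists a, (f s), c; rewrite (stable_invD fP) sD cD; move: ao.
rewrite mem_open_arcs => /and3P[aD a_s ge_a]; split=> //.
rewrite /nesting lt_a lt_c le_c ne (stable_invK fP) c_s /= ltn_neqAle ge_a andbT.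
by apply: contraTneq lt_a => /val_inj ->; rewrite (stable_invK fP) ltnn.
Qed.

(** The pair is complete when the first of its arcs closes. *)
Lemma no_bad_closure_crossing dots f : stable_inv f ->
  no_bad_closure dots true 0 f = ~~ arc_pattern (crossing_over dots f).
Proof.
move=> fP; apply/forallP/idP => [ok|].
  apply/arc_patternP => -[a [b [c [aD bD cD /and5P[ab bc le_c ne /andP[ca ab']]]]]].
  have /negP := ok (f a); apply; rewrite /bad_closure (stable_invK fP)
    (stable_invD fP) aD /=.
  have b_a : b < f a by lia.
  have a_a : a < f a by lia.
  rewrite a_a; apply/existsP; exists b;
    rewrite mem_open_arcs bD b_a (ltnW ab') /= ab /=.
  by apply/existsP; exists c; apply/and5P.
move=> no s; apply/implyP => _; apply: contra no.
case/and3P=> sD lt_s /existsP[b /and3P[bo lt_b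
  /existsP[c /and5P[cD lt_c le_c c_s ne]]]].
apply/arc_patternP; exists (f s), b, c; rewrite (stable_invD fP) sD cD; move: bo.
rewrite mem_open_arcs => /and3P[bD b_s ge_b]; split=> //.
rewrite /crossing_over lt_b lt_c le_c ne (stable_invK fP) c_s /= ltn_neqAle ge_b
  andbT.
by apply: contraTneq lt_b => /val_inj ->; rewrite (stable_invK fP) ltnn.
Qed.

Lemma chain3_pending_word (r : rel nat) t f : chain r 3 (pending_word t f) <->
  exists i j k : 'I_n, [/\ [/\ i \in D, j \in D & k \in D],
    [/\ t <= i, i < j & j < k],
    [/\ f i < t, f j < t & f k < t], r (f i) (f j) & r (f j) (f k)].
Proof.
pose lt := relpre (@nat_of_ord n) ltn; rewrite /pending_word.
have lt_trans : transitive lt by move=> y x z; exact: ltn_trans.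
set l := [seq j <- _ | _].
have so : sorted lt l.
  apply: sorted_filter => //; apply: drop_sorted.
  by rewrite -sorted_map val_enum_ord iota_ltn_sorted.
have lE j : (j \in l) = [&& j \in D, f j < t & t <= j].
  by rewrite mem_filter mem_drop_enum andbA.
split=> [[s [/subseqP[m _ ->]]]|[i [j [k]]]].
  rewrite -map_mask size_map; have sub := mask_subseq m l.
  have mem_l := mem_subseq sub; have := subseq_sorted lt_trans sub so.
  case: (mask m l) mem_l => [|i [|j [|k [|? ?]]]] //= mem_l /and3P[ij jk _].
  move=> /and3P[rij rjk _] _; exists i, j, k.
  have := mem_l i; have := mem_l j; have := mem_l k.
  rewrite !lE !inE !eqxx !orbT => /(_ isT)/and3P[-> -> _].
  by move=> /(_ isT)/and3P[-> -> _] /(_ isT)/and3P[-> -> ->].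
case=> -[iD jD kD] [ti ij jk] [fi fj fk] rij rjk.
exists (map (fun j => val (f j)) [:: i; j; k]); split;
  [|by rewrite /= rij rjk|by []].
apply: map_subseq.
suff -> : [:: i; j; k] = [seq x <- l | x \in [:: i; j; k]] by exact: filter_subseq.
apply: (@irr_sorted_eq _ lt) => //.
- by move=> x; rewrite /lt /= ltnn.
- by rewrite /= /lt /= ij jk.
- exact: sorted_filter.
move=> x; rewrite mem_filter lE andb_idr // !inE => /or3P[]/eqP->.
- by rewrite iD fi ti.
- by rewrite jD fj (leq_trans ti) // ltnW.
- by rewrite kD fk (leq_trans ti) // ltnW // (ltn_trans ij).
Qed.

Lemma shapes_avoid_crossing3 f : stable_inv f ->
  shapes_avoid 2 0 0 f = ~~ arc_pattern (crossing3 f).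
Proof.
move=> fP; apply/forallP/idP => [ok|no s].
  apply/arc_patternP => -[a [b [c [aD bD cD /and5P[ab bc ca ab' bc']]]]].
  (* All three arcs straddle f a, where the first of them closes. *)
  have := ok (widen_ord (leqnSn n) (f a)); rewrite /= leqNgt => /negP[].
  apply/(row_len_chain 2 (pending_word_uniq _ fP))/chain3_pending_word.
  exists (f a), (f b), (f c); rewrite !(stable_invD fP) !(stable_invK fP) leqnn.
  by split=> //; split=> //; lia.
apply/implyP => _; rewrite leqNgt; apply: contra no.
move/(row_len_chain 2 (pending_word_uniq _ fP))/chain3_pending_word.
case=> i [j [k [[iD jD kD] [ti ij jk] [fi fj fk] rij rjk]]].
rewrite /= in rij rjk; apply/arc_patternP; exists (f i), (f j), (f k).
by rewrite !(stable_invD fP) /crossing3 !(stable_invK fP) rij rjk ij jk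
  (leq_trans fk ti).
Qed.

Lemma shapes_avoid_nesting f : stable_inv f ->
  shapes_avoid 0 2 0 f = ~~ arc_pattern (nesting false f).
Proof.
move=> fP; apply/forallP/idP => [ok|no s].
  apply/arc_patternP => -[a [b [c [aD bD cD /and5P[ab bc le_c ne /andP[cb ba]]]]]].
  have lt_c : c < f c by rewrite ltn_neqAle le_c andbT eq_sym.
  (* All three arcs straddle f c, where the innermost one closes. *)
  have := ok (widen_ord (leqnSn n) (f c)); rewrite /= leqNgt => /negP[].
  apply/(row0_len_chain 3 (pending_word_uniq _ fP))/chain3_pending_word.
  exists (f c), (f b), (f a); rewrite !(stable_invD fP) !(stable_invK fP) leqnn.
  by split=> //; split=> //; lia.
apply/implyP => _; rewrite leqNgt; apply: contra no.
move/(row0_len_chain 3 (pending_word_uniq _ fP))/chain3_pending_word.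
case=> i [j [k [[iD jD kD] [ti ij jk] [fi fj fk] rij rjk]]].
apply/arc_patternP; exists (f k), (f j), (f i).
rewrite !(stable_invD fP) /nesting !(stable_invK fP); split=> //;
  rewrite -val_eqE /= in rij rjk *; lia.
Qed.

Theorem card_nesting_crossing dots :
  #|[set f | stable_inv f & ~~ arc_pattern (nesting dots f)]| =
  #|[set f | stable_inv f & ~~ arc_pattern (crossing_over dots f)]|.
Proof.
transitivity #|[set f | stable_inv f & no_bad_closure dots false 0 f]|.
  by apply: eq_card => f; rewrite !in_set; case fP: (stable_inv f) => //=;
    rewrite no_bad_closure_nesting.
transitivity #|[set f | stable_inv f & no_bad_closure dots true 0 f]|.
  by apply: card_inv_classes => f fP; rewrite !(card_no_bad_closure _ _ (add0n n)).
by apply: eq_card => f; rewrite !in_set; case fP: (stable_inv f) => //=;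
  rewrite no_bad_closure_crossing.
Qed.

Theorem card_nesting_crossing3 :
  #|[set f | stable_inv f & ~~ arc_pattern (nesting false f)]| =
  #|[set f | stable_inv f & ~~ arc_pattern (crossing3 f)]|.
Proof.
transitivity #|[set f | stable_inv f & shapes_avoid 0 2 0 f]|.
  by apply: eq_card => f; rewrite !in_set; case fP: (stable_inv f) => //=;
    rewrite shapes_avoid_nesting.
transitivity #|[set f | stable_inv f & shapes_avoid 2 0 0 f]|.
  by apply: card_inv_classes => f fP;
    rewrite !card_shapes_avoid // shape_walks_transpose.
by apply: eq_card => f; rewrite !in_set; case fP: (stable_inv f) => //=;
  rewrite shapes_avoid_crossing3.
Qed.

End Involutions.

(** * Signed permutations and their patterns *)

Section Signed.
Variable n : nat.
Implicit Types (p : signed_perm n) (f : {ffun 'I_n -> 'I_n}) (D : {set 'I_n}).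

Lemma letter_lt p (i : 'I_n) : `|tnth p i|.-1 < n.
Proof. by have := sp_letter_bounds p i; lia. Qed.

(** Positions and values are shifted from 1, ..., n to 0, ..., n-1. *)
Definition abs_map p : {ffun 'I_n -> 'I_n} := [ffun i => Ordinal (letter_lt p i)].
Definition pos_set p : {set 'I_n} := [set i | (0 < tnth p i)%R].

Lemma abs_letter p i : `|tnth p i| = (abs_map p i).+1.
Proof. by rewrite ffunE /=; have := sp_letter_bounds p i; lia. Qed.

Lemma letterE p i :
  tnth p i = (if i \in pos_set p then (abs_map p i).+1%:Z else -
    (abs_map p i).+1%:Z)%R.
Proof. by rewrite -abs_letter inE; case: ifP; lia. Qed.

Lemma abs_pos_inj : injective (fun p => (pos_set p, abs_map p)).
Proof.
move=> p q [eD ef]; apply: val_inj; apply: eq_from_tnth => i.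
by rewrite !letterE eD ef.
Qed.

Lemma signed_of_inv D f : injective f ->
  exists2 p, pos_set p = D & abs_map p = f.
Proof.
move=> fI; pose w := [tuple (if i \in D then (f i).+1%:Z else - (f i).+1%:Z)%R |
  i < n].
have wP : perm_eq [seq `|x| | x <- w] (iota 1 n).
  rewrite -map_comp (eq_map (g := succn \o val \o f)); last first.
    by move=> i /=; case: ifP; lia.
  have -> : iota 1 n = map succn (map val (enum 'I_n)).
    by rewrite val_enum_ord -(iotaDl 1 0).
  rewrite (map_comp succn) (map_comp val); apply/perm_map/perm_map.
  apply: uniq_perm; [by rewrite (map_inj_uniq fI) enum_uniq|exact: enum_uniq|move=>
    i].
  rewrite mem_enum; apply/mapP.
  by have [g _ fK] := injF_bij fI; exists (g i); rewrite ?mem_enum ?fK.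
exists (SignedPerm wP).
  by apply/setP=> i; rewrite inE tnth_mktuple; case: (i \in D); lia.
apply/ffunP=> i; apply: val_inj; apply: succn_inj; rewrite -abs_letter tnth_mktuple.
by case: (i \in D) => /=; lia.
Qed.

Lemma sp_mxE p i j : sp_mx p i j =
  (if abs_map p i == j then if i \in pos_set p then 1 else -1 else 0)%R.
Proof.
rewrite mxE abs_letter eqSS -val_eqE; case: eqP => // _.
rewrite letterE; case: ifP => _; rewrite ?sgrN; lia.
Qed.

(** Symmetry of the matrix says that the unsigned map is an involution and that
partners have the same sign. *)
Lemma sp_involutionE p : sp_involution p = stable_inv (pos_set p) (abs_map p).
Proof.
rewrite sp_involution_sym; apply/eqP/idP => [sym|pP].
  have fD i : abs_map p (abs_map p i) = i /\ (abs_map p i \in pos_set p) =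
    (i \in pos_set p).
    have := congr1 (fun M : 'M_n => M i (abs_map p i)) sym.
    rewrite [RHS]mxE !sp_mxE eqxx; case: eqP => [->|_]; last by case: ifP.
    by case: (i \in _); case: (_ \in _).
  by apply/andP; split; apply/forallP => i; apply/eqP; case: (fD i).
apply/matrixP => i j; rewrite [RHS]mxE !sp_mxE.
case: eqP => [<-|ne]; first by rewrite (stable_invK pP) eqxx (stable_invD pP).
by case: eqP => // ji; case: ne; rewrite -ji (stable_invK pP).
Qed.

Definition has_pattern k (w : seq nat) D f :=
  [exists h : {ffun 'I_k -> 'I_n},
    [&& [forall a : 'I_k, forall b : 'I_k, (a < b) ==> (h a < h b)],
        [forall a : 'I_k, forall b : 'I_k,
          (f (h a) < f (h b)) == (nth 0 w a < nth 0 w b)] &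
        [forall a, h a \in D]]].

Lemma sp_contains_pattern p (w : seq nat) (z : seq int) zP :
  z = map Posz w -> all (ltn 0) w ->
  sp_contains p (@sp_of_word z zP) = has_pattern (size z) w (pos_set p) (abs_map p).
Proof.
move=> zE /allP w_gt0.
have sz : size z = size w by rewrite zE size_map.
have nth_z m : m < size w -> nth 0%R z m = nth 0 w m.
  by move=> m_w; rewrite zE (nth_map 0).
have zw (a : 'I_(size z)) : tnth (sp_of_word zP) a = nth 0 w a.
  by rewrite (tnth_nth 0%R) /= nth_z // -sz.
have z_gt0 (a : 'I_(size z)) : 0 < nth 0 w a.
  by apply/w_gt0/mem_nth; rewrite -sz.
apply: eq_existsb => h; congr [&& _, _ & _].
  apply: eq_forallb => a; apply: eq_forallb => b; rewrite !zw.
  by rewrite -!abszE !abs_letter !ltz_nat ltnS.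
apply: eq_forallb => a; rewrite inE zw ltz_nat z_gt0.
by case: (0 < _)%R.
Qed.

Lemma has_patternP k w D f : reflect
  (exists h : 'I_k -> 'I_n, [/\ forall a b : 'I_k, a < b -> h a < h b,
     forall a b : 'I_k, (f (h a) < f (h b)) = (nth 0 w a < nth 0 w b)
     & forall a, h a \in D])
  (has_pattern k w D f).
Proof.
apply: (iffP existsP) => [[h /and3P[/forallP incr /forallP iso /forallP hD]]|[h
  [incr iso hD]]].
  exists h; split=> // a b; first by have /forallP/(_ b)/implyP := incr a.
  by have /forallP/(_ b)/eqP := iso a.
exists (finfun h); apply/and3P; split; apply/forallP=> a; rewrite ?ffunE //.
  by apply/forallP=> b; rewrite !ffunE; apply/implyP/incr.
by apply/forallP=> b; rewrite !ffunE iso.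
Qed.

Definition count_avoiding k w := \sum_(D : {set 'I_n})
  #|[set f | stable_inv D f & ~~ has_pattern k w D f]|.

Lemma card_SI_avoiding (w : seq nat) (z : seq int) zP :
  z = map Posz w -> all (ltn 0) w ->
  #|SI_avoiding n (@sp_of_word z zP)| = count_avoiding (size z) w.
Proof.
move=> zE w_gt0; rewrite -(card_imset _ abs_pos_inj).
rewrite -sum1_card (partition_big (fun Df => Df.1) predT) //=;
  apply: eq_bigr => D _.
have pairI : injective (fun f => (D, f)) by move=> f g [].
rewrite -(card_imset _ pairI) -sum1_card; apply: eq_bigl => -[D' f].
apply/andP/imsetP => [[/imsetP[p pS [-> ->]] /eqP /= <-]|[f' + [-> ->]]].
  exists (abs_map p) => //; move: pS.
  by rewrite !in_set sp_involutionE (sp_contains_pattern _ _ zE w_gt0).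
rewrite in_set => /andP[f'P no]; split=> //=.
have [p pD pf] := signed_of_inv D (can_inj (stable_invK f'P)).
apply/imsetP; exists p; last by rewrite pD pf.
by rewrite !in_set sp_involutionE (sp_contains_pattern _ _ zE w_gt0) pD pf f'P.
Qed.

Lemma sorted_nth_lt (i0 : 'I_n) s a b : sorted ltn (map val s) -> a < b ->
  b < size s ->
  nth i0 s a < nth i0 s b.
Proof.
move=> so ab b_s; have a_s := ltn_trans ab b_s.
have: nth 0 (map val s) a < nth 0 (map val s) b.
  by apply: (sorted_ltn_nth ltn_trans) => //; rewrite inE size_map.
by rewrite !(nth_map i0).
Qed.

Lemma sorted_nth_ltE (i0 : 'I_n) s a b : sorted ltn (map val s) ->
  a < size s -> b < size s -> (nth i0 s a < nth i0 s b) = (a < b).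
Proof.
move=> so a_s b_s; case: (ltngtP a b) => [ab|ba|->]; last by rewrite ltnn.
  exact: sorted_nth_lt.
by apply/negbTE; rewrite -leqNgt ltnW ?sorted_nth_lt.
Qed.

(** For an involution the positions s of an occurrence and its values v, both in
increasing order, are known explicitly. The order isomorphism then reduces to
the equation between lists, which is checked by computation. *)
Lemma has_pattern_seq (i0 : 'I_n) s v k w D f : size s = k -> size v = k ->
  size w = k -> all (fun x => 0 < x <= k) w ->
  sorted ltn (map val s) -> sorted ltn (map val v) -> all (mem D) s ->
  map f s = [seq nth i0 v x.-1 | x <- w] -> has_pattern k w D f.
Proof.
move=> sz vz wz /allP w_k so vo /allP sD fs; apply/has_patternP.
exists (fun a => nth i0 s a); split=> [a b ab|a b|a].
- by apply: sorted_nth_lt; rewrite ?sz.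
- have fE (c : 'I_k) : f (nth i0 s c) = nth i0 v (nth 0 w c).-1.
    by rewrite -(nth_map i0 i0) ?sz // fs (nth_map 0) ?wz.
  have wE (c : 'I_k) : 0 < nth 0 w c <= k by apply/w_k/mem_nth; rewrite wz.
  have := wE a; have := wE b; rewrite !fE => wa wb.
  by rewrite sorted_nth_ltE ?vz //; lia.
- by apply/sD/mem_nth; rewrite sz.
Qed.

Local Notation o5 k := (@Ordinal 5 k isT).
Local Notation o6 k := (@Ordinal 6 k isT).

(** Here and in the next four lemmas, an occurrence of the pattern at positions
h 0 < h 1 < ... consists of the points (h i, f (h i)). If its first three points
are far enough above the diagonal, they form the wanted triple; otherwise the
last three points are below it, and their mirror images do. *)
Lemma pattern54321 D f : stable_inv D f ->
  has_pattern 5 [:: 5; 4; 3; 2; 1] D f = arc_pattern D (nesting true f).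
Proof.
move=> fP; apply/has_patternP/arc_patternP => [[h [incr iso hD]]|].
  have h0 := incr (o5 0) (o5 1) isT.
  have h1 := incr (o5 1) (o5 2) isT.
  have h2 := incr (o5 2) (o5 3) isT.
  have h3 := incr (o5 3) (o5 4) isT.
  have f0 := iso (o5 4) (o5 3).
  have f1 := iso (o5 3) (o5 2).
  have f2 := iso (o5 2) (o5 1).
  have f3 := iso (o5 1) (o5 0).
  rewrite /= in f0 f1 f2 f3.
  case: (leqP (h (o5 2)) (f (h (o5 2)))) => side.
    exists (h (o5 0)), (h (o5 1)), (h (o5 2)); split=> //.
    by rewrite ?/nesting ?/crossing_over ?/crossing3 -?val_eqE /=; lia.
  exists (f (h (o5 4))), (f (h (o5 3))), (f (h (o5 2))).
  by rewrite ?/nesting ?/crossing_over ?/crossing3 !(stable_invK fP)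
    !(stable_invD fP) -?val_eqE /=; split=> //; lia.
case=> a [b [c [aD bD cD /and5P[ab bc le_c _ /andP[cb ba]]]]].
apply/has_patternP; apply: (@has_pattern_seq a [:: a; b; c; f b; f a]
  [:: a; b; f c; f b; f a]) => //=.
- by lia.
- by lia.
- by rewrite ?(stable_invD fP) ?aD ?bD ?cD.
- by rewrite !(stable_invK fP).
Qed.

Lemma pattern45312 D f : stable_inv D f ->
  has_pattern 5 [:: 4; 5; 3; 1; 2] D f = arc_pattern D (crossing_over true f).
Proof.
move=> fP; apply/has_patternP/arc_patternP => [[h [incr iso hD]]|].
  have h0 := incr (o5 0) (o5 1) isT.
  have h1 := incr (o5 1) (o5 2) isT.
  have h2 := incr (o5 2) (o5 3) isT.
  have h3 := incr (o5 3) (o5 4) isT.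
  have f0 := iso (o5 3) (o5 4).
  have f1 := iso (o5 4) (o5 2).
  have f2 := iso (o5 2) (o5 0).
  have f3 := iso (o5 0) (o5 1).
  rewrite /= in f0 f1 f2 f3.
  case: (leqP (h (o5 2)) (f (h (o5 2)))) => side.
    exists (h (o5 0)), (h (o5 1)), (h (o5 2)); split=> //.
    by rewrite ?/nesting ?/crossing_over ?/crossing3 -?val_eqE /=; lia.
  exists (f (h (o5 3))), (f (h (o5 4))), (f (h (o5 2))).
  by rewrite ?/nesting ?/crossing_over ?/crossing3 !(stable_invK fP)
    !(stable_invD fP) -?val_eqE /=; split=> //; lia.
case=> a [b [c [aD bD cD /and5P[ab bc le_c _ /andP[ca ab']]]]].
apply/has_patternP; apply: (@has_pattern_seq a [:: a; b; c; f a; f b]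
  [:: a; b; f c; f a; f b]) => //=.
- by lia.
- by lia.
- by rewrite ?(stable_invD fP) ?aD ?bD ?cD.
- by rewrite !(stable_invK fP).
Qed.

Lemma pattern654321 D f : stable_inv D f ->
  has_pattern 6 [:: 6; 5; 4; 3; 2; 1] D f = arc_pattern D (nesting false f).
Proof.
move=> fP; apply/has_patternP/arc_patternP => [[h [incr iso hD]]|].
  have h0 := incr (o6 0) (o6 1) isT.
  have h1 := incr (o6 1) (o6 2) isT.
  have h2 := incr (o6 2) (o6 3) isT.
  have h3 := incr (o6 3) (o6 4) isT.
  have h4 := incr (o6 4) (o6 5) isT.
  have f0 := iso (o6 5) (o6 4).
  have f1 := iso (o6 4) (o6 3).
  have f2 := iso (o6 3) (o6 2).
  have f3 := iso (o6 2) (o6 1).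
  have f4 := iso (o6 1) (o6 0).
  rewrite /= in f0 f1 f2 f3 f4.
  case: (leqP (h (o6 2)).+1 (f (h (o6 2)))) => side.
    exists (h (o6 0)), (h (o6 1)), (h (o6 2)); split=> //.
    by rewrite ?/nesting ?/crossing_over ?/crossing3 -?val_eqE /=; lia.
  exists (f (h (o6 5))), (f (h (o6 4))), (f (h (o6 3))).
  by rewrite ?/nesting ?/crossing_over ?/crossing3 !(stable_invK fP)
    !(stable_invD fP) -?val_eqE /=; split=> //; lia.
case=> a [b [c [aD bD cD /and5P[ab bc le_c ne /andP[cb ba]]]]].
rewrite -val_eqE /= in ne.
apply/has_patternP; apply: (@has_pattern_seq a [:: a; b; c; f c; f b; f a]
  [:: a; b; c; f c; f b; f a]) => //=.
- by lia.
- by lia.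
- by rewrite ?(stable_invD fP) ?aD ?bD ?cD.
- by rewrite !(stable_invK fP).
Qed.

Lemma pattern456123 D f : stable_inv D f ->
  has_pattern 6 [:: 4; 5; 6; 1; 2; 3] D f = arc_pattern D (crossing3 f).
Proof.
move=> fP; apply/has_patternP/arc_patternP => [[h [incr iso hD]]|].
  have h0 := incr (o6 0) (o6 1) isT.
  have h1 := incr (o6 1) (o6 2) isT.
  have h2 := incr (o6 2) (o6 3) isT.
  have h3 := incr (o6 3) (o6 4) isT.
  have h4 := incr (o6 4) (o6 5) isT.
  have f0 := iso (o6 3) (o6 4).
  have f1 := iso (o6 4) (o6 5).
  have f2 := iso (o6 5) (o6 0).
  have f3 := iso (o6 0) (o6 1).
  have f4 := iso (o6 1) (o6 2).
  rewrite /= in f0 f1 f2 f3 f4.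
  case: (leqP (h (o6 2)).+1 (f (h (o6 0)))) => side.
    exists (h (o6 0)), (h (o6 1)), (h (o6 2)); split=> //.
    by rewrite ?/nesting ?/crossing_over ?/crossing3 -?val_eqE /=; lia.
  exists (f (h (o6 3))), (f (h (o6 4))), (f (h (o6 5))).
  by rewrite ?/nesting ?/crossing_over ?/crossing3 !(stable_invK fP)
    !(stable_invD fP) -?val_eqE /=; split=> //; lia.
case=> a [b [c [aD bD cD /and5P[ab bc ca ab' bc']]]].
apply/has_patternP; apply: (@has_pattern_seq a [:: a; b; c; f a; f b; f c]
  [:: a; b; c; f a; f b; f c]) => //=.
- by lia.
- by lia.
- by rewrite ?(stable_invD fP) ?aD ?bD ?cD.
- by rewrite !(stable_invK fP).
Qed.

Lemma pattern564312 D f : stable_inv D f ->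
  has_pattern 6 [:: 5; 6; 4; 3; 1; 2] D f = arc_pattern D (crossing_over false f).
Proof.
move=> fP; apply/has_patternP/arc_patternP => [[h [incr iso hD]]|].
  have h0 := incr (o6 0) (o6 1) isT.
  have h1 := incr (o6 1) (o6 2) isT.
  have h2 := incr (o6 2) (o6 3) isT.
  have h3 := incr (o6 3) (o6 4) isT.
  have h4 := incr (o6 4) (o6 5) isT.
  have f0 := iso (o6 4) (o6 5).
  have f1 := iso (o6 5) (o6 3).
  have f2 := iso (o6 3) (o6 2).
  have f3 := iso (o6 2) (o6 0).
  have f4 := iso (o6 0) (o6 1).
  rewrite /= in f0 f1 f2 f3 f4.
  case: (leqP (h (o6 2)).+1 (f (h (o6 2)))) => side.
    exists (h (o6 0)), (h (o6 1)), (h (o6 2)); split=> //.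
    by rewrite ?/nesting ?/crossing_over ?/crossing3 -?val_eqE /=; lia.
  exists (f (h (o6 4))), (f (h (o6 5))), (f (h (o6 3))).
  by rewrite ?/nesting ?/crossing_over ?/crossing3 !(stable_invK fP)
    !(stable_invD fP) -?val_eqE /=; split=> //; lia.
case=> a [b [c [aD bD cD /and5P[ab bc le_c ne /andP[ca ab']]]]].
rewrite -val_eqE /= in ne.
apply/has_patternP; apply: (@has_pattern_seq a [:: a; b; c; f c; f a; f b]
  [:: a; b; c; f c; f a; f b]) => //=.
- by lia.
- by lia.
- by rewrite ?(stable_invD fP) ?aD ?bD ?cD.
- by rewrite !(stable_invK fP).
Qed.

End Signed.

Theorem corollary2p5 :
  sp_of_word (w := [:: 5; 4; 3; 2; 1]%Z) isT
    ~I sp_of_word (w := [:: 4; 5; 3; 1; 2]%Z) isT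
  /\ sp_of_word (w := [:: 6; 5; 4; 3; 2; 1]%Z) isT
    ~I sp_of_word (w := [:: 4; 5; 6; 1; 2; 3]%Z) isT
  /\ sp_of_word (w := [:: 4; 5; 6; 1; 2; 3]%Z) isT
    ~I sp_of_word (w := [:: 5; 6; 4; 3; 1; 2]%Z) isT.
Proof.
have card_eq (n k : nat) (w w' : seq nat) :
    (forall D : {set 'I_n}, #|[set f | stable_inv D f & ~~ has_pattern k w D f]| =
                            #|[set f | stable_inv D f & ~~ has_pattern k w' D f]|)
                              ->
    count_avoiding n k w = count_avoiding n k w'.
  by move=> eq_w; apply: eq_bigr => D _.
have rew n (D : {set 'I_n}) k w R :
    (forall f, stable_inv D f -> has_pattern k w D f = arc_pattern D (R f)) ->
    #|[set f | stable_inv D f & ~~ has_pattern k w D f]| =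
    #|[set f | stable_inv D f & ~~ arc_pattern D (R f)]|.
  move=> wR; apply: eq_card => f; rewrite !in_set.
  by case fP: (stable_inv D f) => //=; rewrite wR.
split; [|split] => n _.
- rewrite (@card_SI_avoiding n [:: 5; 4; 3; 2; 1] _ _ erefl isT).
  rewrite (@card_SI_avoiding n [:: 4; 5; 3; 1; 2] _ _ erefl isT).
  apply: card_eq => D; rewrite (rew _ _ _ _ _ (@pattern54321 n D)).
  by rewrite (rew _ _ _ _ _ (@pattern45312 n D)) card_nesting_crossing.
- rewrite (@card_SI_avoiding n [:: 6; 5; 4; 3; 2; 1] _ _ erefl isT).
  rewrite (@card_SI_avoiding n [:: 4; 5; 6; 1; 2; 3] _ _ erefl isT).
  apply: card_eq => D; rewrite (rew _ _ _ _ _ (@pattern654321 n D)).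
  by rewrite (rew _ _ _ _ _ (@pattern456123 n D)) card_nesting_crossing3.
- rewrite (@card_SI_avoiding n [:: 4; 5; 6; 1; 2; 3] _ _ erefl isT).
  rewrite (@card_SI_avoiding n [:: 5; 6; 4; 3; 1; 2] _ _ erefl isT).
  apply: card_eq => D; rewrite (rew _ _ _ _ _ (@pattern456123 n D)).
  rewrite (rew _ _ _ _ _ (@pattern564312 n D)).
  by rewrite -card_nesting_crossing3 card_nesting_crossing.
Qed.
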